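(* Let $\beta=(\pi_\ell)_{\ell=1}^L$ be a non-redundant chainable architecture of depth $L\ge 2$, let $\mathbf{A}\in\mathbb{C}^{m\times n}$ with $m=a_1b_1d_1$, $n=a_Lc_Ld_L$, and let $\sigma=(\sigma_1,\dots,\sigma_{L-1})$ be any permutation of $\{1,\dots,L-1\}$. Then the butterfly algorithm with inputs $(\mathbf{A},\beta,\sigma)$ returns $(\mathbf{X}_\ell)_{\ell=1}^L\in\Sigma^\beta$ such that $$\|\mathbf{A}-\mathbf{X}_1\cdots\mathbf{X}_L\|_F\le\sum_{k=1}^{L-1}E^{\beta_{\sigma_k}}(\mathbf{A}).$$
   Context: A pattern is a tuple $\pi=(a,b,c,d)$ of positive integers; $\mathbf{S}_\pi:=\mathbf{I}_a\otimes\mathbf{1}_{b\times c}\otimes\mathbf{I}_d\in\{0,1\}^{abd\times acd}$. A $\pi$-factor is a complex $abd\times acd$ matrix with support contained in that of $\mathbf{S}_\pi$; $\Sigma^\pi$ is the set of $\pi$-factors. Patterns $\pi_1=(a_1,b_1,c_1,d_1),\pi_2=(a_2,b_2,c_2,d_2)$ are chainable if $a_1c_1/a_2=b_2d_2/d_1=:r(\pi_1,\pi_2)$ is an integer, $a_1\mid a_2$, $d_2\mid d_1$; then $\pi_1*\pi_2:=(a_1,b_1d_1/d_2,a_2c_2/a_1,d_2)$; such a pair is redundant if $r(\pi_1,\pi_2)\ge\min(b_1,c_2)$. An architecture $\beta=(\pi_\ell)_{\ell=1}^L$ is a sequence of patterns with $a_\ell c_\ell d_\ell=a_{\ell+1}b_{\ell+1}d_{\ell+1}$;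 it is chainable if consecutive pairs are chainable and redundant if some consecutive pair is redundant. $\pi_{[p,q]}:=\pi_p*\cdots*\pi_q$ (iterated product, well defined for chainable $\beta$). $\Sigma^\beta:=\Sigma^{\pi_1}\times\cdots\times\Sigma^{\pi_L}$. For $s\in\{1,\dots,L-1\}$, $\beta_s:=(\pi_{[1,s]},\pi_{[s+1,L]})$ and $E^{\beta_s}(\mathbf{A}):=\min_{\mathbf{X}\in\Sigma^{\pi_{[1,s]}},\mathbf{Y}\in\Sigma^{\pi_{[s+1,L]}}}\|\mathbf{A}-\mathbf{X}\mathbf{Y}\|_F$. For binary $\mathbf{L},\mathbf{R}$ with $\mathbf{U}_i:=\mathbf{L}[:,i]\mathbf{R}[i,:]$, $\mathcal{P}(\mathbf{L},\mathbf{R})$ is the partition of column indices of $\mathbf{L}$ into classes of the relation $\mathbf{U}_i=\mathbf{U}_j$, and $R_P\times C_P$ is the support of $\mathbf{U}_i$ for $i\in P$. TwoFactor$(\mathbf{M},\pi,\pi')$: zero $\mathbf{X},\mathbf{Y}$ of $\pi$-, $\pi'$-factor sizes; for each $P\in\mathcal{P}(\mathbf{S}_\pi,\mathbf{S}_{\pi'})$ set $(\mathbf{X}[R_P,P],\mathbf{Y}[P,C_P])$ to any minimizer $(\mathbf{H},\mathbf{K})$ of $\|\mathbf{M}[R_P,C_P]-\mathbf{H}\mathbf{K}\|_F$ over $\mathbf{H}\in\mathbb{C}^{|R_P|\times|P|},\mathbf{K}\in\mathbb{C}^{|P|\times|C_P|}$. Ortho$(\pi,\pi',\mathbf{X},\mathbf{Y},u)$: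 zero $\tilde{\mathbf{X}},\tilde{\mathbf{Y}}$; for each $P\in\mathcal{P}(\mathbf{S}_\pi,\mathbf{S}_{\pi'})$: if $u=$ column, QR-decompose $\mathbf{X}[R_P,P]=\mathbf{Q}\mathbf{R}$ and set $\tilde{\mathbf{X}}[R_P,P]=\mathbf{Q}$, $\tilde{\mathbf{Y}}[P,C_P]=\mathbf{R}\mathbf{Y}[P,C_P]$; if $u=$ row, QR-decompose $\mathbf{Y}[P,C_P]^\top=\mathbf{Q}\mathbf{R}$ and set $\tilde{\mathbf{X}}[R_P,P]=\mathbf{X}[R_P,P]\mathbf{R}^\top$, $\tilde{\mathbf{Y}}[P,C_P]=\mathbf{Q}^\top$. Butterfly algorithm: keep consecutive intervals $I_1,\dots,I_J$ partitioning $\{1,\dots,L\}$ with factors $\mathbf{X}_{I_k}$, initially $I_1=[1,L]$, $\mathbf{X}_{I_1}=\mathbf{A}$. For $J=1,\dots,L-1$: $s=\sigma_J$, $j$ with $s\in I_j=[q,t]$; for $k=1,\dots,j-1$: $(\mathbf{X}_{I_k},\mathbf{X}_{I_{k+1}})\leftarrow$ Ortho$(\pi_{I_k},\pi_{I_{k+1}},\mathbf{X}_{I_k},\mathbf{X}_{I_{k+1}},\text{column})$; for $k=J,\dots,j+1$ (decreasing): $(\mathbf{X}_{I_{k-1}},\mathbf{X}_{I_k})\leftarrow$ Ortho$(\pi_{I_{k-1}},\pi_{I_k},\mathbf{X}_{I_{k-1}},\mathbf{X}_{I_k},\text{row})$; then $(\mathbf{X}_{[q,s]},\mathbf{X}_{[s+1,t]})\leftarrow$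 TwoFactor$(\mathbf{X}_{I_j},\pi_{[q,s]},\pi_{[s+1,t]})$ and $I_j$ is replaced by $[q,s],[s+1,t]$. Output $(\mathbf{X}_{[\ell,\ell]})_{\ell=1}^L$. *)

(* Defs.v *)
From HB Require Import structures.
From mathcomp Require Import all_boot all_order all_algebra.
From mathcomp Require Import complex.
From mathcomp Require Import classical_sets reals.

Set Implicit Arguments.
Unset Strict Implicit.
Unset Printing Implicit Defensive.

Import Order.TTheory GRing.Theory Num.Theory.
Local Open Scope ring_scope.

(* Patterns pi = (a,b,c,d) and their supports S_pi = I_a (x) 1_{bxc} (x) I_d *)

Record pattern := Pat { pa : nat; pb : nat; pc : nat; pd : nat }.

Definition pos_pattern (p : pattern) : bool :=
  [&& 0 < pa p, 0 < pb p, 0 < pc p & 0 < pd p]%N.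

Definition prows (p : pattern) : nat := (pa p * pb p * pd p)%N.
Definition pcols (p : pattern) : nat := (pa p * pc p * pd p)%N.

(* (i,j) (0-based) lies in the support of S_pi : writing
   i = i1*(b d) + i2*d + i3 and j = j1*(c d) + j2*d + j3,
   the entry of I_a (x) 1_{bxc} (x) I_d is [i1 = j1][i3 = j3]. *)
Definition supp (p : pattern) (i j : nat) : bool :=
  (i %/ (pb p * pd p) == j %/ (pc p * pd p))%N && (i %% pd p == j %% pd p)%N.

Definition chainable (p1 p2 : pattern) : Prop :=
  [/\ (pa p2 %| pa p1 * pc p1)%N, (pd p1 %| pb p2 * pd p2)%N,
      (pa p1 * pc p1 %/ pa p2 = pb p2 * pd p2 %/ pd p1)%N,
      (pa p1 %| pa p2)%N & (pd p2 %| pd p1)%N].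

Definition ratio (p1 p2 : pattern) : nat := (pa p1 * pc p1 %/ pa p2)%N.

Definition pat_mul (p1 p2 : pattern) : pattern :=
  Pat (pa p1) (pb p1 * pd p1 %/ pd p2) (pa p2 * pc p2 %/ pa p1) (pd p2).

Definition redundant_pair (p1 p2 : pattern) : Prop :=
  (minn (pb p1) (pc p2) <= ratio p1 p2)%N.

(* Architectures: beta = [:: pi_1; ...; pi_L], 1-based access          *)

Definition pat (beta : seq pattern) (l : nat) : pattern :=
  nth (Pat 1 1 1 1) beta l.-1.

Definition is_arch (beta : seq pattern) : Prop :=
  all pos_pattern beta /\
  forall l, (1 <= l < size beta)%N ->
    (pa (pat beta l) * pc (pat beta l) * pd (pat beta l) =
     pa (pat beta l.+1) * pb (pat beta l.+1) * pd (pat beta l.+1))%N.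

Definition chainable_arch (beta : seq pattern) : Prop :=
  forall l, (1 <= l < size beta)%N -> chainable (pat beta l) (pat beta l.+1).

Definition redundant_arch (beta : seq pattern) : Prop :=
  exists l, (1 <= l < size beta)%N /\ redundant_pair (pat beta l) (pat beta l.+1).

Definition prodpat (beta : seq pattern) (p q : nat) : pattern :=
  foldl (fun acc l => pat_mul acc (pat beta l)) (pat beta p) (iota p.+1 (q - p)).

Section Mx.
Variable R : realType.
Local Notation C := (R[i]).

(* Complex matrices of arbitrary size (the algorithm manipulates       *)
(* matrices of varying sizes); entries accessed by nat indices         *)
(* (0 outside the matrix).                                             *)

Record mxs := MX { nr : nat; nc : nat; mxof : 'M[C]_(nr, nc) }.

Definition ent (A : mxs) (i j : nat) : C :=
  match (insub i : option 'I_(nr A)), (insub j : option 'I_(nc A)) with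
  | Some i', Some j' => mxof A i' j'
  | _, _ => 0
  end.

Definition mx0 : mxs := MX (0 : 'M[C]_(0, 0)).

(* product (the inner dimension is nc A; equals nr B when well typed) *)
Definition mulx (A B : mxs) : mxs :=
  MX (\matrix_(i < nr A, j < nc B) \sum_(k < nc A) mxof A i k * ent B k j).

Definition subx (A B : mxs) : mxs :=
  MX (\matrix_(i < nr A, j < nc A) (mxof A i j - ent B i j)).

Definition prodx (xs : seq mxs) : mxs :=
  match xs with [::] => mx0 | x :: xs' => foldl mulx x xs' end.

Definition cnorm (z : C) : R := ComplexField.Normc.normc z.

Definition frob (A : mxs) : R :=
  Num.sqrt (\sum_(i < nr A) \sum_(j < nc A) cnorm (mxof A i j) ^+ 2).

Definition is_factor (p : pattern) (X : mxs) : Prop :=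
  [/\ nr X = prows p, nc X = pcols p &
      forall (i : 'I_(nr X)) (j : 'I_(nc X)), ~~ supp p i j -> mxof X i j = 0].

Definition in_Sigma (beta : seq pattern) (xs : seq mxs) : Prop :=
  size xs = size beta /\
  forall l, (1 <= l <= size beta)%N -> is_factor (pat beta l) (nth mx0 xs l.-1).

(* E^{beta_s}(A) = min over X in Sigma^{pi_[1,s]}, Y in Sigma^{pi_[s+1,L]}
   of ||A - XY||_F  (the minimum is attained; we use the infimum). *)
Definition Eerr (beta : seq pattern) (s : nat) (A : mxs) : R :=
  inf [set x : R | exists X Y, [/\ is_factor (prodpat beta 1 s) X,
                                    is_factor (prodpat beta s.+1 (size beta)) Y &
                                    x = frob (subx A (mulx X Y))]].

(* The partition P(S_pi, S_pi') of the column indices of S_pi.         *)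
(* U_i = S_pi[:,i] S_pi'[i,:]; i ~ j iff U_i = U_j.                    *)

Definition Uent (p p' : pattern) (i r c : nat) : bool :=
  [&& (r < prows p)%N, supp p r i, (c < pcols p')%N & supp p' i c].

Definition sameU (p p' : pattern) (i j : nat) : bool :=
  [forall r : 'I_(prows p), forall c : 'I_(pcols p'),
      Uent p p' i r c == Uent p p' j r c].

Definition inP (p p' : pattern) (i j : nat) : bool :=
  (j < pcols p)%N && sameU p p' i j.

(* R_P x C_P = support of U_i (i in P) *)
Definition inRP (p p' : pattern) (i r : nat) : bool :=
  [exists c : 'I_(pcols p'), Uent p p' i r c].
Definition inCP (p p' : pattern) (i c : nat) : bool :=
  [exists r : 'I_(prows p), Uent p p' i r c].

Definition block_supported (p p' : pattern) (X Y : mxs) : Prop :=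
  [/\ (nr X, nc X) = (prows p, pcols p), (nr Y, nc Y) = (prows p', pcols p'),
      (forall r j, ~~ inRP p p' j r -> ent X r j = 0) &
      (forall j c, ~~ inCP p p' j c -> ent Y j c = 0)].

Definition blockerr (p p' : pattern) (M : mxs) (i : nat) (H K : nat -> nat -> C) : R :=
  Num.sqrt (\sum_(r < prows p | inRP p p' i r) \sum_(c < pcols p' | inCP p p' i c)
     cnorm (ent M r c - \sum_(j < pcols p | inP p p' i j) H r j * K j c) ^+ 2).

(* TwoFactor(M, pi, pi') may return (X, Y) *)
Definition twofactor (p p' : pattern) (M X Y : mxs) : Prop :=
  block_supported p p' X Y /\
  forall i, (i < pcols p)%N -> forall H K : nat -> nat -> C,
    blockerr p p' M i (ent X) (ent Y) <= blockerr p p' M i H K.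

(* Ortho(pi, pi', X, Y, u) may return (X', Y') *)
Inductive odir := OCol | ORow.

Definition ortho (u : odir) (p p' : pattern) (X Y X' Y' : mxs) : Prop :=
  block_supported p p' X' Y' /\
  forall i, (i < pcols p)%N ->
  exists Q Rm : nat -> nat -> C,
    (forall j j', inP p p' i j -> inP p p' i j' -> (j' < j)%N -> Rm j j' = 0) /\
    match u with
    | OCol =>
      [/\
          forall j j', inP p p' i j -> inP p p' i j' ->
            \sum_(r < prows p | inRP p p' i r) conjc (Q r j) * Q r j' = (j == j')%:R,
          forall r j, inRP p p' i r -> inP p p' i j ->
            ent X r j = \sum_(j' < pcols p | inP p p' i j') Q r j' * Rm j' j,
          forall r j, inRP p p' i r -> inP p p' i j -> ent X' r j = Q r j &
          forall j c, inP p p' i j -> inCP p p' i c ->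
            ent Y' j c = \sum_(j' < pcols p | inP p p' i j') Rm j j' * ent Y j' c]
    | ORow =>
      [/\
          forall j j', inP p p' i j -> inP p p' i j' ->
            \sum_(c < pcols p' | inCP p p' i c) conjc (Q c j) * Q c j' = (j == j')%:R,
          forall j c, inP p p' i j -> inCP p p' i c ->
            ent Y j c = \sum_(j' < pcols p | inP p p' i j') Q c j' * Rm j' j,
          forall j c, inP p p' i j -> inCP p p' i c -> ent Y' j c = Q c j &
          forall r j, inRP p p' i r -> inP p p' i j ->
            ent X' r j = \sum_(j' < pcols p | inP p p' i j') ent X r j' * Rm j j']
    end.

(* The butterfly algorithm, as a relation (QR factors and minimizers    *)
(* are arbitrary choices).  A state is the list of the intervals        *)
(* I_1,...,I_J (as pairs (q,t), 1-based) with their factors X_{I_k}.    *)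

Definition state := seq ((nat * nat) * mxs).
Definition dflt_entry : (nat * nat) * mxs := ((0, 0)%N, mx0).

Definition ipat (beta : seq pattern) (I : nat * nat) : pattern := prodpat beta I.1 I.2.

Definition ortho_step (u : odir) (beta : seq pattern) (k : nat) (st st' : state) : Prop :=
  (1 <= k < size st)%N /\
  let e1 := nth dflt_entry st k.-1 in
  let e2 := nth dflt_entry st k in
  exists X' Y', ortho u (ipat beta e1.1) (ipat beta e2.1) e1.2 e2.2 X' Y' /\
    st' = set_nth dflt_entry (set_nth dflt_entry st k.-1 (e1.1, X')) k (e2.1, Y').

Fixpoint rel_seq (T : Type) (Rk : nat -> T -> T -> Prop) (ks : seq nat) (x y : T) : Prop :=
  match ks with
  | [::] => y = x
  | k :: ks' => exists z, Rk k x z /\ rel_seq Rk ks' z y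
  end.

Definition bstep (beta : seq pattern) (J s : nat) (st st' : state) : Prop :=
  exists j, (1 <= j <= size st)%N /\
  let q := (nth dflt_entry st j.-1).1.1 in
  let t := (nth dflt_entry st j.-1).1.2 in
  (q <= s <= t)%N /\
  exists st1 st2,
    rel_seq (ortho_step OCol beta) (iota 1 j.-1) st st1 /\
    rel_seq (ortho_step ORow beta) (rev (iota j (J - j))) st1 st2 /\
    exists X Y,
      twofactor (prodpat beta q s) (prodpat beta s.+1 t) (nth dflt_entry st2 j.-1).2 X Y /\
      st' = take j.-1 st2 ++ [:: ((q, s), X); ((s.+1, t), Y)] ++ drop j st2.

Definition butterfly (beta : seq pattern) (sigma : seq nat) (A : mxs) (out : seq mxs) : Prop :=
  exists stf : state,
    rel_seq (fun J => bstep beta J (nth 0%N sigma J.-1)) (iota 1 (size beta).-1)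
            [:: ((1, size beta)%N, A)] stf /\
    out = map snd stf.

End Mx.

(* Main.v *)
(* Index the interfaces between factors by [u = 0, ..., L].  For a cut [s], a
   matrix belongs to the products of [Sigma^{beta_s}] iff it vanishes off the
   global support and each of its disjoint blocks [R_P x C_P] has rank at most
   [|P|]; when the cut moves to the right the row sets of the blocks get coarser
   and the column sets finer.

   One step.  The QR passes make the product of the factors left of the split
   column-orthonormal on each block, and the product of those on its right
   row-orthonormal.  Hence a best block approximation of the middle factor gives
   a best block approximation of the whole product [B], so the step moves [B] by
   at most its distance to the products of [Sigma^{beta_s}].

   Monotonicity.  A best rank-[r] approximation [H K] of a block is both a left
   and a right orthogonal projection of it.  Replacing all [s]-blocks by their
   left (resp. right) projections is a linear contraction which maps the
   products of [Sigma^{beta_s'}] to themselves for [s' > s] (resp. [s' < s]), so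
   no step increases the distance to the cuts still to come.  Summing the steps
   gives the bound.

   Existence.  QR factors with orthonormal columns exist because non-redundancy
   makes every class [P] no larger than [R_P] and [C_P], and best approximations
   exist by the spectral theorem and Ky Fan's inequality.

   Reversing the product and transposing exchanges left and right, so every
   right-hand statement is the left-hand one for the dual system. *)
Require Import Defs.
From mathcomp Require Import all_boot all_order all_algebra.
From mathcomp Require Import complex spectral sesquilinear.
From mathcomp Require Import boolp classical_sets reals.
From mathcomp Require Import zify ring.

Set Implicit Arguments.
Unset Strict Implicit.
Unset Printing Implicit Defensive.

Import Order.TTheory GRing.Theory Num.Theory.
Local Open Scope ring_scope.
Local Open Scope sesquilinear_scope.

(** * Frobenius norm, QR decomposition and best low-rank approximation *)

Section TopValues.
Variable F : numDomainType.

Definition selects_top n r (lam : 'I_n -> F) (f : 'I_r -> 'I_n) :=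
  injective f /\ forall i j, i \notin codom f -> lam i <= lam (f j).

(* Multiplying both sides by the total mass moved avoids choosing a threshold
   between the values of [lam] inside and outside the range of [f]. *)
Lemma selects_top_weighted_sum n r (lam w : 'I_n -> F) (f : 'I_r -> 'I_n) :
  selects_top lam f -> (forall i, 0 <= lam i) -> (forall i, 0 <= w i <= 1) ->
  \sum_i w i = r%:R -> \sum_i lam i * w i <= \sum_j lam (f j).
Proof.
move=> [f_inj ftop] lam0 w01 sumw.
have w0 i : 0 <= w i by case/andP: (w01 i).
have split_codom (g : 'I_n -> F) :
    \sum_i g i = \sum_j g (f j) + \sum_(i | i \notin codom f) g i.
  rewrite (bigID (mem (codom f))) /=; congr (_ + _).
  rewrite -(big_map f predT g) big_uniq ?(map_inj_uniq f_inj) ?index_enum_uniq //.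
  by apply: eq_bigl => i; rewrite codomE enumT.
pose outside := \sum_(i | i \notin codom f) lam i * w i.
pose missing := \sum_j lam (f j) * (1 - w (f j)).
pose mass := \sum_(i | i \notin codom f) w i.
have massE : mass = \sum_j (1 - w (f j)).
  move: sumw; rewrite split_codom -/mass sumrB sumr_const card_ord => <-.
  by rewrite addrAC subrr add0r.
suff outside_le : outside <= missing.
  rewrite split_codom -/outside -lerBrDl -sumrB; apply: le_trans outside_le _.
  by apply: ler_sum => j _; rewrite mulrBr mulr1.
have [mass0|mass_neq0] := eqVneq mass 0.
  rewrite /outside big1 => [|i iout].
    by apply: sumr_ge0 => j _; rewrite mulr_ge0 // subr_ge0; case/andP: (w01 (f j)).
  by rewrite (psumr_eq0P (fun i _ => w0 i) mass0) ?mulr0.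
have mass_gt0 : 0 < mass by rewrite lt_def mass_neq0 sumr_ge0.
rewrite -(ler_pM2l mass_gt0) {1}massE /mass !mulr_suml.
under eq_bigr do rewrite mulr_sumr.
under [leRHS]eq_bigr do rewrite mulr_sumr.
rewrite exchange_big; apply: ler_sum => i iout; apply: ler_sum => j _.
have -> : (1 - w (f j)) * (lam i * w i) = lam i * (w i * (1 - w (f j))) by ring.
have -> : w i * (lam (f j) * (1 - w (f j))) = lam (f j) * (w i * (1 - w (f j))) by ring.
by rewrite ler_wpM2r ?ftop // mulr_ge0 // subr_ge0; case/andP: (w01 (f j)).
Qed.

Lemma selects_top_exists n r (lam : 'I_n -> F) : (r <= n)%N ->
  (forall i, lam i \is Num.real) ->
  exists f : 'I_r -> 'I_n, selects_top lam f.
Proof.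
move=> rn lam_real; pose f0 : {ffun 'I_r -> 'I_n} := [ffun j => widen_ord rn j].
have f0_inj : injectiveb f0.
  by apply/injectiveP => x y; rewrite !ffunE => /(congr1 val) /= e; apply: val_inj.
have sum_real (f : {ffun 'I_r -> 'I_n}) : injectiveb f -> \sum_j lam (f j) \is Num.real.
  by move=> _; apply: rpred_sum.
case: (real_arg_maxP f0_inj sum_real) => f /injectiveP f_inj fmax.
exists f; split=> // i j0 iout.
pose g : {ffun 'I_r -> 'I_n} := [ffun j => if j == j0 then i else f j].
have g_inj : injectiveb g.
  apply/injectiveP => x y; rewrite !ffunE.
  case: eqVneq => [->|nx]; case: eqVneq => [->|ny] // e.
  - by case/negP: iout; rewrite e codom_f.
  - by case/negP: iout; rewrite -e codom_f.
  - exact: f_inj.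
have : \sum_j lam (g j) <= \sum_j lam (f j) := fmax g g_inj.
rewrite (bigD1 j0) //= [leRHS](bigD1 j0) //= {1}ffunE eqxx.
rewrite (eq_bigr (fun j => lam (f j))) ?lerD2r // => j jj0.
by rewrite ffunE (negPf jj0).
Qed.

End TopValues.

Section Frobenius.
Variable C : numClosedFieldType.

Lemma trmxC_mul m n p (A : 'M[C]_(m, n)) (B : 'M[C]_(n, p)) :
  (A *m B)^t* = B^t* *m A^t*.
Proof. by rewrite trmx_mul map_mxM. Qed.

Lemma trmxCB m n (A B : 'M[C]_(m, n)) : (A - B)^t* = A^t* - B^t*.
Proof. by rewrite raddfB map_mxB. Qed.

Definition normF2 m n (A : 'M[C]_(m, n)) : C := \tr (A^t* *m A).

Lemma normF2E m n (A : 'M[C]_(m, n)) :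
  normF2 A = \sum_i \sum_j `|A i j| ^+ 2.
Proof.
rewrite exchange_big; apply: eq_bigr => j _; rewrite mxE.
by apply: eq_bigr => i _; rewrite !mxE normCK mulrC.
Qed.

Lemma normF20 m n : normF2 (0 : 'M[C]_(m, n)) = 0.
Proof. by rewrite /normF2 mulmx0 raddf0. Qed.

Lemma normF2_ge0 m n (A : 'M[C]_(m, n)) : 0 <= normF2 A.
Proof.
by rewrite normF2E; apply: sumr_ge0 => i _; apply: sumr_ge0 => j _; apply: exprn_ge0.
Qed.

Lemma normF2_le0 m n (A : 'M[C]_(m, n)) : normF2 A <= 0 -> A = 0.
Proof.
move=> le0; have /eqP : normF2 A = 0 by apply/eqP; rewrite eq_le le0 normF2_ge0.
have sq_ge0 i j : 0 <= `|A i j| ^+ 2 by apply: exprn_ge0.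
rewrite normF2E pair_big psumr_eq0 => [/allP A0|[i j] _]; last exact: sq_ge0.
apply/matrixP => i j; have /= := A0 (i, j) (mem_index_enum _).
by rewrite expf_eq0 normr_eq0 => /eqP ->; rewrite mxE.
Qed.

Lemma normF2_trmx m n (A : 'M[C]_(m, n)) : normF2 A^T = normF2 A.
Proof.
rewrite !normF2E exchange_big; apply: eq_bigr => i _.
by apply: eq_bigr => j _; rewrite mxE.
Qed.

Lemma normF2B m n (A B : 'M[C]_(m, n)) :
  normF2 (A - B) = normF2 A - \tr (A^t* *m B) - \tr (B^t* *m A) + normF2 B.
Proof. by rewrite /normF2 trmxCB mulmxBl !mulmxBr !raddfB /=; ring. Qed.

Definition isometrymx m n (Q : 'M[C]_(m, n)) := Q^t* *m Q = 1%:M.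

Lemma normF2_isometry m n p (Q : 'M[C]_(m, n)) (A : 'M_(n, p)) :
  isometrymx Q -> normF2 (Q *m A) = normF2 A.
Proof.
by move=> Qiso; rewrite /normF2 trmxC_mul mulmxA -(mulmxA _ _ Q) Qiso mulmx1.
Qed.

Lemma normF2_sub_isometry m n p (Q : 'M[C]_(m, n)) (M : 'M_(m, p)) (W : 'M_(n, p)) :
  isometrymx Q ->
  normF2 (M - Q *m W) = normF2 M - normF2 (Q^t* *m M) + normF2 (Q^t* *m M - W).
Proof.
move=> Qiso; rewrite !normF2B (normF2_isometry W Qiso) !trmxC_mul trmxCK !mulmxA.
by ring.
Qed.

Lemma normF2_adj_isometry m n p (Q : 'M[C]_(m, n)) (M : 'M_(m, p)) :
  isometrymx Q -> normF2 (Q^t* *m M) <= normF2 M.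
Proof.
move=> Qiso; rewrite -subr_ge0.
have := normF2_sub_isometry M (Q^t* *m M) Qiso.
by rewrite subrr normF20 addr0 => <-; apply: normF2_ge0.
Qed.

Definition qr_decomposition n p (X Q : 'M[C]_(n, p)) (R : 'M_p) :=
  [/\ isometrymx Q, forall i j : 'I_p, (j < i)%N -> R i j = 0 & X = Q *m R].

Lemma qr_exists n p (X : 'M[C]_(n, p)) : (p <= n)%N -> exists Q R, qr_decomposition X Q R.
Proof.
move=> pn; pose S := schmidt X^T; pose W := X^T *m S^t*.
have SS : S *m S^t* = 1%:M by apply/unitarymxP/schmidt_unitarymx.
exists S^T, W^T; split.
- by apply: trmx_inj; rewrite trmx_mul map_trmx !trmxK trmx1.
- move=> i j ji; have -> : W^T i j = (row j X^T *m (row i S)^t*) 0 0.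
    by rewrite !mxE; apply: eq_bigr => k _; rewrite !mxE.
  have /sub_sumsmxP[u ->] := row_schmidt_sub X^T j.
  rewrite mulmx_suml summxE big1 // => k kj.
  have /submxP[D ->] : (u k *m <<row k S>> <= row k S)%MS.
    by rewrite (submx_trans (submxMl _ _)) // genmxE.
  rewrite -mulmxA mxE big1 // => l _; suff -> : (row k S *m (row i S)^t*) l 0 = 0.
    by rewrite mulr0.
  transitivity ((1%:M : 'M[C]_p) k i); last first.
    by rewrite mxE -val_eqE ltn_eqF // (leq_ltn_trans kj).
  by rewrite -SS !mxE; apply: eq_bigr => c _; rewrite !mxE.
- apply: trmx_inj; rewrite trmx_mul !trmxK /W.
  by have /submxP[D ->] := schmidt_sub X^T; rewrite -/S mulmxtVK // schmidt_unitarymx.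
Qed.

Definition best_lowrank n m r (M : 'M[C]_(n, m)) (H : 'M_(n, r)) (K : 'M_(r, m)) :=
  forall (H' : 'M_(n, r)) (K' : 'M_(r, m)), normF2 (M - H *m K) <= normF2 (M - H' *m K').

Lemma best_lowrank_trmx n m r (M : 'M[C]_(n, m)) (H : 'M_(n, r)) (K : 'M_(r, m)) :
  best_lowrank M H K -> best_lowrank M^T K^T H^T.
Proof.
move=> best H' K'; rewrite -normF2_trmx -(normF2_trmx (_ - H' *m K')).
by rewrite !raddfB /= !trmx_mul !trmxK; apply: best.
Qed.

Lemma best_lowrank_isometry n' n m r (Q : 'M[C]_(n', n)) (M : 'M_(n, m))
    (H : 'M_(n, r)) (K : 'M_(r, m)) :
  isometrymx Q -> best_lowrank M H K -> best_lowrank (Q *m M) (Q *m H) K.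
Proof.
move=> Qiso best H' K'; rewrite -mulmxA -mulmxBr normF2_isometry //.
apply: le_trans (best (Q^t* *m H') K') _.
have -> : M - Q^t* *m H' *m K' = Q^t* *m (Q *m M - H' *m K').
  by rewrite mulmxBr !mulmxA Qiso mul1mx.
exact: normF2_adj_isometry.
Qed.

(* By QR the columns of an optimal [H] lie in an orthonormal frame [Q], and the
   Pythagorean identity forces [H K] to be the projection of [M] onto it. *)
Lemma best_lowrank_projection n m r (M : 'M[C]_(n, m)) (H : 'M_(n, r)) (K : 'M_(r, m)) :
  (r <= n)%N -> best_lowrank M H K ->
  exists2 Q : 'M_(n, r), isometrymx Q & H *m K = Q *m Q^t* *m M.
Proof.
move=> rn best; have [Q [R [Qiso _ HE]]] := qr_exists H rn.
have HK : H *m K = Q *m (R *m K) by rewrite HE mulmxA.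
exists Q => //; have := best Q (Q^t* *m M).
rewrite HK !(normF2_sub_isometry _ _ Qiso) subrr normF20 lerD2l => /normF2_le0/eqP.
by rewrite subr_eq0 => /eqP <-; rewrite mulmxA.
Qed.

Lemma normF2_adj_mul_diag n m r (d : 'rV[C]_n) (N : 'M_(n, m)) (W : 'M_(n, r)) :
  N *m N^t* = diag_mx d ->
  normF2 (W^t* *m N) = \sum_i d 0 i * \sum_j `|W i j| ^+ 2.
Proof.
move=> NN; rewrite /normF2 mxtrace_mulC trmxC_mul trmxCK mulmxA -(mulmxA _ N) NN.
under [RHS]eq_bigr do rewrite mulr_sumr.
rewrite exchange_big; apply: eq_bigr => j _; rewrite mxE; apply: eq_bigr => i _.
by rewrite mul_mx_diag !mxE normCK; ring.
Qed.

Lemma ky_fan_le n m r (d : 'rV[C]_n) (N : 'M_(n, m)) (Q : 'M_(n, r)) (f : 'I_r -> 'I_n) :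
  N *m N^t* = diag_mx d -> isometrymx Q -> (forall i, 0 <= d 0 i) -> selects_top (d 0) f ->
  normF2 (Q^t* *m N) <= \sum_j d 0 (f j).
Proof.
move=> NN Qiso d0 ftop; rewrite (normF2_adj_mul_diag Q NN).
apply: selects_top_weighted_sum => // [i|].
  apply/andP; split; first by apply: sumr_ge0 => j _; apply: exprn_ge0.
  have := normF2_adj_isometry (delta_mx i 0 : 'cV_n) Qiso.
  rewrite (normF2E (delta_mx _ _)) (bigD1 i) //= [X in _ + X]big1 ?addr0 => [|k ki].
    rewrite big_ord1 mxE !eqxx normr1 expr1n; apply: le_trans.
    rewrite normF2E; apply: ler_sum => j _; rewrite big_ord1 -colE !mxE.
    by rewrite norm_conjC.
  by rewrite big_ord1 mxE (negPf ki) normr0 expr0n.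
by rewrite -normF2E /normF2 [_ *m _]Qiso mxtrace1.
Qed.

Lemma best_lowrank_orthogonal_rows n m r (d : 'rV[C]_n) (N : 'M_(n, m)) :
  (r <= n)%N -> N *m N^t* = diag_mx d ->
  exists (H : 'M_(n, r)) (K : 'M_(r, m)), best_lowrank N H K.
Proof.
move=> rn NN; have d0 i : 0 <= d 0 i.
  have /matrixP/(_ i i) := NN; rewrite !mxE eqxx mulr1n => <-.
  by apply: sumr_ge0 => k _; rewrite !mxE; apply: mul_conjC_ge0.
have [f ftop] := selects_top_exists rn (fun i => ger0_real (d0 i)); have [f_inj _] := ftop.
pose H : 'M[C]_(n, r) := colsub f 1%:M.
have Hiso : isometrymx H.
  apply/matrixP => j j'; rewrite !mxE (bigD1 (f j)) //= big1 ?addr0 => [|k kj].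
    by rewrite !mxE eqxx conjC1 mul1r (inj_eq f_inj).
  by rewrite !mxE (negPf kj) conjC0 mul0r.
exists H, (H^t* *m N) => H' K'.
have [Q [R [Qiso _ ->]]] := qr_exists H' rn.
rewrite -mulmxA (normF2_sub_isometry _ _ Hiso) (normF2_sub_isometry _ _ Qiso).
rewrite subrr normF20 addr0 ler_wpDr ?normF2_ge0 // lerD2l lerN2.
suff -> : normF2 (H^t* *m N) = \sum_j d 0 (f j) by apply: ky_fan_le.
rewrite (normF2_adj_mul_diag H NN); under eq_bigr do rewrite mulr_sumr.
rewrite exchange_big; apply: eq_bigr => j _; rewrite (bigD1 (f j)) //= big1 => [|k kj].
  by rewrite !mxE eqxx normr1 expr1n mulr1 addr0.
by rewrite !mxE (negPf kj) normr0 expr0n mulr0.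
Qed.

Lemma best_lowrank_exists n m r (M : 'M[C]_(n, m)) : (r <= n)%N ->
  exists (H : 'M_(n, r)) (K : 'M_(r, m)), best_lowrank M H K.
Proof.
move=> rn; pose G := M *m M^t*; pose U := spectralmx G.
pose d := spectral_diag G.
have Uunitary : U \is unitarymx := spectral_unitarymx G.
have UU : U *m U^t* = 1%:M := unitarymxP Uunitary.
have Gnormal : G \is normalmx by apply/normalmxP; rewrite trmxC_mul trmxCK.
have NN : (U *m M) *m (U *m M)^t* = diag_mx d.
  rewrite trmxC_mul mulmxA -(mulmxA U) -/G (orthomx_spectralP Gnormal) -/U -/d.
  by rewrite invmx_unitary // !mulmxA UU mul1mx -mulmxA UU mulmx1.
have [H [K best]] := best_lowrank_orthogonal_rows rn NN.
exists (U^t* *m H), K; rewrite -[M](mul1mx) -(mulmx1C UU) -mulmxA.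
by apply: best_lowrank_isometry best; rewrite /isometrymx trmxCK.
Qed.

End Frobenius.

(** * Submatrices on index sets *)

Section Restriction.

Definition selectmx (V : Type) m n (A : {set 'I_m}) (D : {set 'I_n})
  (M : 'M[V]_(m, n)) : 'M_(#|A|, #|D|) := mxsub enum_val enum_val M.

Lemma selectmx_trmx (V : Type) m n (A : {set 'I_m}) (D : {set 'I_n}) (M : 'M[V]_(m, n)) :
  (selectmx A D M)^T = selectmx D A M^T.
Proof. exact: trmx_mxsub. Qed.

Lemma selectmx_eqP (V : Type) m n (A : {set 'I_m}) (D : {set 'I_n}) (M M' : 'M[V]_(m, n)) :
  (forall i j, i \in A -> j \in D -> M i j = M' i j) <-> selectmx A D M = selectmx A D M'.
Proof.
split=> [MM'|/matrixP MM' i j iA jD].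
  by apply/matrixP => a b; rewrite !mxE MM' ?enum_valP.
have := MM' (enum_rank_in iA i) (enum_rank_in jD j).
by rewrite !mxE !enum_rankK_in.
Qed.

Lemma selectmxB (V : zmodType) m n (A : {set 'I_m}) (D : {set 'I_n}) (M M' : 'M[V]_(m, n)) :
  selectmx A D (M - M') = selectmx A D M - selectmx A D M'.
Proof. by apply/matrixP => a b; rewrite !mxE. Qed.

Lemma selectmx_mul (R : nzRingType) m n p (A : {set 'I_m}) (T : {set 'I_n})
    (D : {set 'I_p}) (X : 'M[R]_(m, n)) (Y : 'M_(n, p)) :
  (forall i k j, i \in A -> j \in D -> X i k != 0 -> Y k j != 0 -> k \in T) ->
  selectmx A D (X *m Y) = selectmx A T X *m selectmx T D Y.
Proof.
move=> XYT; apply/matrixP => a b; rewrite !mxE (bigID (mem T)) /=.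
rewrite [X in _ + X]big1 => [|k kT].
  by rewrite addr0 big_enum_val; apply: eq_bigr => c _; rewrite !mxE.
have [->|Xnz] := eqVneq (X (enum_val a) k) 0; first by rewrite mul0r.
have [->|Ynz] := eqVneq (Y k (enum_val b)) 0; first by rewrite mulr0.
by rewrite (XYT _ _ _ (enum_valP a) (enum_valP b) Xnz Ynz) in kT.
Qed.

Lemma selectmx1 (R : nzRingType) n (A : {set 'I_n}) :
  selectmx A A 1%:M = 1%:M :> 'M[R]_#|A|.
Proof. by apply/matrixP => a b; rewrite !mxE (inj_eq enum_val_inj). Qed.

Definition extendmx (V : nmodType) m n (A : {set 'I_m}) (D : {set 'I_n})
    (Z : 'M[V]_(#|A|, #|D|)) : 'M_(m, n) :=
  \matrix_(i, j) \sum_(a | enum_val a == i) \sum_(b | enum_val b == j) Z a b.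

Lemma extendmxE (V : nmodType) m n (A : {set 'I_m}) (D : {set 'I_n})
    (Z : 'M[V]_(#|A|, #|D|)) a b : extendmx Z (enum_val a) (enum_val b) = Z a b.
Proof.
rewrite mxE (big_pred1 a) => [|a']; last by rewrite /= (inj_eq enum_val_inj).
by rewrite (big_pred1 b) // => b' /=; rewrite (inj_eq enum_val_inj).
Qed.

Lemma extendmxK (V : nmodType) m n (A : {set 'I_m}) (D : {set 'I_n})
    (Z : 'M[V]_(#|A|, #|D|)) : selectmx A D (extendmx Z) = Z.
Proof. by apply/matrixP => a b; rewrite mxE extendmxE. Qed.

Variable C : numClosedFieldType.

Lemma selectmx_adj m n (A : {set 'I_m}) (D : {set 'I_n}) (M : 'M[C]_(m, n)) :
  (selectmx A D M)^t* = selectmx D A (M^t*).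
Proof. by apply/matrixP => a b; rewrite !mxE. Qed.

Lemma normF2_selectmx m n (A : {set 'I_m}) (D : {set 'I_n}) (M : 'M[C]_(m, n)) :
  normF2 (selectmx A D M) = \sum_(i in A) \sum_(j in D) `|M i j| ^+ 2.
Proof.
rewrite normF2E [RHS]big_enum_val; apply: eq_bigr => a _.
by rewrite [RHS]big_enum_val; apply: eq_bigr => b _; rewrite mxE.
Qed.

End Restriction.

(** * Interfaces between factors *)

Definition same_labels (T : Type) (dim : T -> nat)
    (left_label right_label : T -> forall v, 'I_(dim v) -> nat)
    u t v w (i : 'I_(dim v)) (j : 'I_(dim w)) : bool :=
  (left_label u v i == left_label u w j) && (right_label t v i == right_label t w j).

(* The interfaces are the cuts of a product of factors, and [below] is their
   order from left to right. An index [i] of any interface above [u] has a label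
   [left_label u i], and an index of any interface below [t] a label
   [right_label t i]; a factor from [u] to [t] may only be nonzero where both
   labels agree.  Exchanging the two families of labels reverses the order. *)
Record interface_system := InterfaceSystem {
  iface :> Type;
  below : rel iface;
  idim : iface -> nat;
  left_label : iface -> forall v, 'I_(idim v) -> nat;
  right_label : iface -> forall v, 'I_(idim v) -> nat;
  below_refl_l : forall u v, below u v -> below u u;
  below_refl_r : forall u v, below u v -> below v v;
  below_trans : forall u v w, below u v -> below v w -> below u w;
  left_label_coarsen : forall u u' v w (i : 'I_(idim v)) (j : 'I_(idim w)),
    below u u' -> below u' v -> below u' w ->
    left_label u' i = left_label u' j -> left_label u i = left_label u j;
  right_label_coarsen : forall t t' v w (i : 'I_(idim v)) (j : 'I_(idim w)),
    below t' t -> below v t' -> below w t' ->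
    right_label t' i = right_label t' j -> right_label t i = right_label t j;
  labels_realized : forall u v t w w' (i : 'I_(idim w)) (j : 'I_(idim w')),
    below u v -> below v t -> below u w -> below w' t ->
    exists k : 'I_(idim v),
      left_label u k = left_label u i /\ right_label t k = right_label t j;
  card_class_left : forall u s (k : 'I_(idim s)), below u s ->
    (#|[set k' : 'I_(idim s) | same_labels left_label right_label s s k' k]| <=
     #|[set i : 'I_(idim u) | same_labels left_label right_label u s i k]|)%N;
  card_class_right : forall s t (k : 'I_(idim s)), below s t ->
    (#|[set k' : 'I_(idim s) | same_labels left_label right_label s s k' k]| <=
     #|[set j : 'I_(idim t) | same_labels left_label right_label s t j k]|)%N }.

Definition linked (W : interface_system) (u t v w : W)
    (i : 'I_(idim v)) (j : 'I_(idim w)) :=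
  same_labels (@left_label W) (@right_label W) u t i j.

Lemma same_labels_dual (T : Type) (dim : T -> nat)
    (left_label right_label : T -> forall v, 'I_(dim v) -> nat) u t v w
    (i : 'I_(dim v)) (j : 'I_(dim w)) :
  same_labels right_label left_label t u i j = same_labels left_label right_label u t i j.
Proof. exact: andbC. Qed.

#[local] Obligation Tactic := idtac.

Program Definition dual_system (W : interface_system) : interface_system :=
  @InterfaceSystem W (fun u v => below v u) (@idim W) (@right_label W) (@left_label W)
    _ _ _ _ _ _ _ _.
Next Obligation. by move=> W u v; apply: below_refl_r. Qed.
Next Obligation. by move=> W u v; apply: below_refl_l. Qed.
Next Obligation. by move=> W u v w uv vw; apply: below_trans vw uv. Qed.
Next Obligation. by move=> W u u' v w i j; apply: right_label_coarsen. Qed.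
Next Obligation. by move=> W u u' v w i j; apply: left_label_coarsen. Qed.
Next Obligation.
move=> W u v t w w' i j uv vt uw w't.
by have [k []] := labels_realized j i vt uv w't uw; exists k.
Qed.
Next Obligation.
move=> W u s k us; have := card_class_right k us.
by congr (_ <= _)%N; apply: eq_card => j; rewrite !inE same_labels_dual.
Qed.
Next Obligation.
move=> W s t k st; have := card_class_left k st.
by congr (_ <= _)%N; apply: eq_card => j; rewrite !inE same_labels_dual.
Qed.

Section Interfaces.
Variable W : interface_system.
Local Notation N := (@idim W).
Implicit Types u s t v w : W.

Lemma linkedxx u t v (i : 'I_(N v)) : linked u t i i.
Proof. by rewrite /linked /same_labels !eqxx. Qed.

Lemma linked_sym u t v w (i : 'I_(N v)) (j : 'I_(N w)) : linked u t i j = linked u t j i.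
Proof. by rewrite /linked /same_labels eq_sym [in X in _ && X]eq_sym. Qed.

Lemma linked_trans u t v v' w (i : 'I_(N v)) (k : 'I_(N v')) (j : 'I_(N w)) :
  linked u t i k -> linked u t k j -> linked u t i j.
Proof.
by move=> /andP[/eqP l /eqP r] /andP[l' r']; rewrite /linked /same_labels l l' r r'.
Qed.

Lemma linked_dual u t v w (i : 'I_(N v)) (j : 'I_(N w)) :
  @linked (dual_system W) t u v w i j = linked u t i j.
Proof. exact: same_labels_dual. Qed.

Lemma linked_coarsen u u' t' t v w (i : 'I_(N v)) (j : 'I_(N w)) :
  below u u' -> below u' v -> below u' w -> below t' t -> below v t' -> below w t' ->
  linked u' t' i j -> linked u t i j.
Proof.
move=> uu' u'v u'w t't vt' wt' /andP[/eqP l /eqP r]; apply/andP; split; apply/eqP.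
  exact: left_label_coarsen l.
exact: right_label_coarsen r.
Qed.

Definition class s (k : 'I_(N s)) : {set 'I_(N s)} := [set k' | linked s s k k'].

Definition rowset u s (P : {set 'I_(N s)}) : {set 'I_(N u)} :=
  [set i | [exists k in P, linked u s i k]].

Definition colset s t (P : {set 'I_(N s)}) : {set 'I_(N t)} :=
  [set j | [exists k in P, linked s t k j]].

Lemma linked_class_left u s (k k' : 'I_(N s)) (i : 'I_(N u)) :
  below u s -> linked s s k k' -> linked u s i k = linked u s i k'.
Proof.
move=> us kk'; have [uu ss] := (below_refl_l us, below_refl_r us).
have {}kk' : linked u s k k' by apply: linked_coarsen kk'.
by apply/idP/idP => ik; apply: linked_trans ik _; rewrite // linked_sym.
Qed.

Lemma linked_class_right s t (k k' : 'I_(N s)) (j : 'I_(N t)) :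
  below s t -> linked s s k k' -> linked s t k j = linked s t k' j.
Proof.
move=> st kk'; have [ss tt] := (below_refl_l st, below_refl_r st).
have {}kk' : linked s t k k' by apply: linked_coarsen kk'.
by apply/idP/idP => kj; apply: linked_trans kj; rewrite // linked_sym.
Qed.

Lemma mem_rowset u s (k : 'I_(N s)) (i : 'I_(N u)) : below u s ->
  (i \in rowset u (class k)) = linked u s i k.
Proof.
move=> us; rewrite inE; apply/exists_inP/idP => [[k']|ik].
  by rewrite inE => kk'; rewrite (linked_class_left i us kk').
by exists k; rewrite // inE linkedxx.
Qed.

Lemma mem_colset s t (k : 'I_(N s)) (j : 'I_(N t)) : below s t ->
  (j \in colset t (class k)) = linked s t k j.
Proof.
move=> st; rewrite inE; apply/exists_inP/idP => [[k']|kj].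
  by rewrite inE => kk'; rewrite (linked_class_right j st kk').
by exists k; rewrite // inE linkedxx.
Qed.

Lemma rowset_class s (k : 'I_(N s)) : below s s -> rowset s (class k) = class k.
Proof. by move=> ss; apply/setP => i; rewrite mem_rowset // inE linked_sym. Qed.

Lemma colset_class s (k : 'I_(N s)) : below s s -> colset s (class k) = class k.
Proof. by move=> ss; apply/setP => j; rewrite mem_colset // inE. Qed.

Lemma card_class_rowset u s (k : 'I_(N s)) : below u s ->
  (#|class k| <= #|rowset u (class k)|)%N.
Proof.
move=> us; have := card_class_left k us; congr (_ <= _)%N; apply: eq_card => i.
  by rewrite !inE linked_sym.
by rewrite inE mem_rowset.
Qed.

Section Cut.
Variables u s t : W.
Hypotheses (us : below u s) (st : below s t).
Let uu : below u u. Proof. exact: below_refl_l us. Qed.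
Let ss : below s s. Proof. exact: below_refl_r us. Qed.
Let tt : below t t. Proof. exact: below_refl_r st. Qed.
Let ut : below u t. Proof. exact: below_trans us st. Qed.
Implicit Types (i : 'I_(N u)) (k : 'I_(N s)) (j : 'I_(N t)).

Lemma linked_through i k j : linked u s i k -> linked s t k j -> linked u t i j.
Proof.
move=> ik kj; apply: (@linked_trans _ _ _ s _ _ k).
  exact: linked_coarsen ik.
exact: linked_coarsen kj.
Qed.

Lemma linked_right_exists k : exists j, linked s t k j.
Proof.
have [j [l r]] := labels_realized k k st tt (below_refl_l st) st.
by exists j; rewrite /linked /same_labels l r !eqxx.
Qed.

Lemma linked_left_exists k : exists i, linked u s i k.
Proof.
have [i [l r]] := labels_realized k k uu us us ss.
by exists i; rewrite /linked /same_labels l r !eqxx.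
Qed.

Lemma linked_factor i j : linked u t i j ->
  exists2 k : 'I_(N s), linked u s i k & linked s t k j.
Proof.
move=> /andP[/eqP l /eqP r]; have [k [lk rk]] := labels_realized j i ss ss st us.
exists k; apply/andP; split; apply/eqP; rewrite ?lk ?rk //.
  by rewrite l; apply: left_label_coarsen (esym lk).
by rewrite -r; apply: right_label_coarsen rk.
Qed.

Definition midclass i j : {set 'I_(N s)} :=
  [set k : 'I_(N s) | linked u s i k && linked s t k j].

Lemma midclassE i k j : linked u s i k -> linked s t k j -> midclass i j = class k.
Proof.
move=> ik kj; apply/setP => k'; rewrite !inE; apply/idP/idP => [/andP[ik' k'j]|kk'].
  move: kj k'j ik ik' => /andP[/eqP l _] /andP[/eqP l' _] /andP[_ /eqP r] /andP[_ /eqP r'].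
  by rewrite /linked /same_labels l l' -r -r' !eqxx.
by rewrite -(linked_class_left i us kk') ik -(linked_class_right j st kk').
Qed.

End Cut.
End Interfaces.

Local Notation block P M := (selectmx (rowset _ P) (colset _ P) M).
Local Notation lblock P X := (selectmx (rowset _ P) P X).
Local Notation rblock P Y := (selectmx P (colset _ P) Y).

Section SupportedMatrices.
Variables (W : interface_system) (C : numClosedFieldType).
Local Notation N := (@idim W).
Implicit Types u s t : W.

Definition supported u t (M : 'M[C]_(N u, N t)) := forall i j, M i j != 0 -> linked u t i j.

Section Cut.
Variables u s t : W.
Hypotheses (us : below u s) (st : below s t).
Let uu : below u u. Proof. exact: below_refl_l us. Qed.
Let ss : below s s. Proof. exact: below_refl_r us. Qed.
Let tt : below t t. Proof. exact: below_refl_r st. Qed.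
Let ut : below u t. Proof. exact: below_trans us st. Qed.
Implicit Types (i : 'I_(N u)) (k : 'I_(N s)) (j : 'I_(N t)).

Lemma supported_mul (X : 'M_(N u, N s)) (Y : 'M_(N s, N t)) :
  supported X -> supported Y -> supported (X *m Y).
Proof.
move=> sX sY i j; rewrite mxE => nz; have [k] : exists k, X i k * Y k j != 0.
  apply/existsP; apply: contraR nz => /existsPn z.
  by rewrite big1 // => k _; apply/eqP; have := z k; rewrite negbK.
by rewrite mulf_eq0 negb_or => /andP[/sX ik /sY]; apply: (linked_through us st).
Qed.

Lemma supported_eq0 (M : 'M_(N u, N t)) i j : supported M -> ~~ linked u t i j -> M i j = 0.
Proof. by move=> sM; apply: contraNeq => /sM. Qed.

Lemma block_mul (X : 'M_(N u, N s)) (Y : 'M_(N s, N t)) k :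
  supported X -> supported Y ->
  block (class k) (X *m Y) = lblock (class k) X *m rblock (class k) Y.
Proof.
move=> sX sY; apply: selectmx_mul => i k' j; rewrite mem_rowset // mem_colset //.
move=> ik kj /sX ik' /sY k'j; rewrite -(midclassE us st ik kj) inE ik' //.
Qed.

Lemma glue_blocks
    (good : forall P : {set 'I_(N s)}, 'M[C]_(#|rowset u P|, #|colset t P|) -> Prop) :
  (forall k, exists Z, good (class k) Z) ->
  exists2 M : 'M_(N u, N t), supported M &
    forall k, good (class k) (block (class k) M).
Proof.
move=> goodP; have goodZ P : exists Z, (exists k, P = class k) -> good P Z.
  have [[k ->]|none] := pselect (exists k, P = class k); last by exists 0.
  by have [Z] := goodP k; exists Z.
pose Z P := sval (cid (goodZ P)).
exists (\matrix_(i, j) if linked u t i j then extendmx (Z (midclass s i j)) i j else 0).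
  by move=> i j; rewrite mxE; case: ifP => //; rewrite eqxx.
move=> k; set M := selectmx _ _ _; suff -> : M = Z (class k).
  by apply: (svalP (cid (goodZ (class k)))); exists k.
apply/matrixP => a b; rewrite !mxE.
have := enum_valP a; rewrite mem_rowset // => ik.
have := enum_valP b; rewrite mem_colset // => kj.
by rewrite (linked_through us st ik kj) (midclassE us st ik kj) -[RHS]extendmxE mxE.
Qed.

Lemma normF2_le_blocks (D E : 'M[C]_(N u, N t)) :
  (forall i j, ~~ linked u t i j -> `|D i j| <= `|E i j|) ->
  (forall k, normF2 (block (class k) D) <= normF2 (block (class k) E)) ->
  normF2 D <= normF2 E.
Proof.
move=> off blocks; pose linked_pair (x : 'I_(N u) * 'I_(N t)) := linked u t x.1 x.2.
pose classes := [set class k | k : 'I_(N s)].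
rewrite !normF2E !pair_big /= (bigID linked_pair) [leRHS](bigID linked_pair) /=.
rewrite lerD //; last by apply: ler_sum => x nx; rewrite lerXn2r ?nnegrE // off.
have mid_class x : linked_pair x -> midclass s x.1 x.2 \in classes.
  by move=> /(linked_factor us st)[k ik kj]; rewrite (midclassE us st ik kj) imset_f.
rewrite !(partition_big _ _ mid_class) /=; apply: ler_sum => _ /imsetP[k _ ->].
have sumE (M : 'M[C]_(N u, N t)) :
    \sum_(x | linked_pair x && (midclass s x.1 x.2 == class k)) `|M x.1 x.2| ^+ 2 =
    normF2 (block (class k) M).
  rewrite normF2_selectmx pair_big /=; apply: eq_bigl => -[i j] /=.
  rewrite mem_rowset // mem_colset //; apply/andP/andP => [[_ /eqP e]|[ik kj]].
    have : k \in midclass s i j by rewrite e inE linkedxx.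
    by rewrite inE => /andP.
  by rewrite /linked_pair /= (linked_through us st ik kj) (midclassE us st ik kj).
by rewrite !sumE.
Qed.

End Cut.
End SupportedMatrices.

(** * Blockwise optimal products *)

Section BlockOptimality.
Variable C : numClosedFieldType.

Section Definitions.
Variable W : interface_system.
Local Notation N := (@idim W).

Definition block_optimal u s t (M : 'M[C]_(N u, N t))
    (X : 'M_(N u, N s)) (Y : 'M_(N s, N t)) :=
  forall k : 'I_(N s), let P := class k in
  best_lowrank (block P M) (lblock P X) (rblock P Y).

Definition label_orthonormal a u (F : 'M[C]_(N a, N u)) :=
  forall i i' : 'I_(N u), left_label u i = left_label u i' ->
    (F^t* *m F) i i' = (i == i')%:R.

Definition block_qr u s t (X : 'M[C]_(N u, N s)) (Y : 'M_(N s, N t))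
    (X' : 'M_(N u, N s)) (Y' : 'M_(N s, N t)) :=
  [/\ supported X', supported Y' &
      forall k : 'I_(N s), let P := class k in
        exists2 R : 'M_#|P|, qr_decomposition (lblock P X) (lblock P X') R &
                             rblock P Y' = R *m rblock P Y].

End Definitions.

Section Duality.
Variable W : interface_system.
Local Notation N := (@idim W).
Local Notation V := (dual_system W).

Lemma class_dual (s : W) (k : 'I_(N s)) : @class V s k = class k.
Proof. by apply/setP => k'; rewrite !inE linked_dual. Qed.

Lemma rowset_dual (s t : W) (P : {set 'I_(N s)}) : @rowset V t s P = colset t P.
Proof.
by apply/setP => j; rewrite !inE; apply: eq_existsb => k; rewrite linked_dual linked_sym.
Qed.

Lemma colset_dual (u s : W) (P : {set 'I_(N s)}) : @colset V s u P = rowset u P.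
Proof.
by apply/setP => i; rewrite !inE; apply: eq_existsb => k; rewrite linked_dual linked_sym.
Qed.

Lemma supported_dual (u t : W) (M : 'M[C]_(N u, N t)) :
  @supported V C t u M^T <-> supported M.
Proof. by split=> sM i j; have := sM j i; rewrite mxE linked_dual linked_sym. Qed.

Lemma block_optimal_dual (u s t : W) (M : 'M[C]_(N u, N t)) X (Y : 'M_(N s, N t)) :
  @block_optimal V t s u M^T Y^T X^T <-> block_optimal M X Y.
Proof.
split=> best k; have /best_lowrank_trmx := best k.
  by rewrite /= class_dual rowset_dual colset_dual !selectmx_trmx !trmxK.
by rewrite /= class_dual rowset_dual colset_dual !selectmx_trmx.
Qed.

End Duality.

Section Cut.
Variables (W : interface_system) (u s t : W).
Local Notation N := (@idim W).
Hypotheses (us : below u s) (st : below s t).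
Let ss : below s s. Proof. exact: below_refl_r us. Qed.

Lemma block_optimal_exists (M : 'M_(N u, N t)) :
  exists X Y, [/\ supported X, supported Y & @block_optimal W u s t M X Y].
Proof.
have [k|X sX bestX] := @glue_blocks W C u s s us ss (fun P H =>
    exists K : 'M_(#|colset s P|, #|colset t P|),
      best_lowrank (block P M) H K).
  by apply: best_lowrank_exists; rewrite colset_class // card_class_rowset.
have [k|Y sY bestY] := @glue_blocks W C s s t ss st (fun P K =>
    best_lowrank (block P M) (selectmx (rowset u P) (rowset s P) X) K).
  by have := bestX k; rewrite rowset_class // colset_class.
by exists X, Y; split=> // k; have := bestY k; rewrite rowset_class.
Qed.

Lemma block_optimal_le (B : 'M_(N u, N t)) (X X1 : 'M_(N u, N s)) (Y Y1 : 'M_(N s, N t)) :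
  block_optimal B X Y -> supported X -> supported Y -> supported X1 -> supported Y1 ->
  normF2 (B - X *m Y) <= normF2 (B - X1 *m Y1).
Proof.
move=> best sX sY sX1 sY1; apply: (normF2_le_blocks us st) => [i j nl|k].
  have off (H : 'M_(N u, N s)) (K : 'M_(N s, N t)) :
      supported H -> supported K -> (B - H *m K) i j = B i j.
    move=> sH sK; have HK0 := supported_eq0 (supported_mul us st sH sK) nl.
    by rewrite 2!mxE HK0 subr0.
  by rewrite !off.
by rewrite !selectmxB !block_mul //; apply: best.
Qed.

Lemma block_qr_exists (X : 'M_(N u, N s)) (Y : 'M_(N s, N t)) :
  exists X' Y', @block_qr W u s t X Y X' Y'.
Proof.
have [k|X' sX' qrX] := @glue_blocks W C u s s us ss (fun P Q =>
    exists R : 'M_#|colset s P|, qr_decomposition (block P X) Q R).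
  by apply: qr_exists; rewrite colset_class // card_class_rowset.
have [k|Y' sY' qrY] := @glue_blocks W C s s t ss st (fun P Z =>
    exists2 R : 'M_#|rowset s P|,
      qr_decomposition (selectmx (rowset u P) (rowset s P) X)
        (selectmx (rowset u P) (rowset s P) X') R &
      Z = R *m block P Y).
  have := qrX k; rewrite rowset_class // colset_class // => -[R qrR].
  by exists (R *m rblock (class k) Y), R.
by exists X', Y'; split=> // k; have := qrY k; rewrite rowset_class.
Qed.

Lemma block_qr_mul (X X' : 'M_(N u, N s)) (Y Y' : 'M_(N s, N t)) :
  block_qr X Y X' Y' -> supported X -> supported Y -> X' *m Y' = X *m Y.
Proof.
move=> [sX' sY' qr] sX sY; apply/matrixP => i j.
have [/(linked_factor us st)[k ik kj]|nl] := boolP (linked u t i j); last first.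
  by rewrite !(supported_eq0 _ nl) //; apply: supported_mul.
have [R [_ _ XE] YE] := qr k.
apply: (selectmx_eqP (rowset u (class k)) (colset t (class k)) _ _).2.
- by rewrite !block_mul // XE YE mulmxA.
- by rewrite mem_rowset.
- by rewrite mem_colset.
Qed.

End Cut.
End BlockOptimality.

Section Transfer.
Variables (C : numClosedFieldType) (W : interface_system).
Local Notation N := (@idim W).
Implicit Types a b u s t : W.

Lemma selectmx_gram u s (X : 'M[C]_(N u, N s)) (k : 'I_(N s)) : below u s -> supported X ->
  (lblock (class k) X)^t* *m lblock (class k) X = selectmx (class k) (class k) (X^t* *m X).
Proof.
move=> us sX; have ss := below_refl_r us; have uu := below_refl_l us.
rewrite selectmx_adj -selectmx_mul // => k1 i k2 _.
rewrite inE mem_rowset // => kk2 _ /sX ik2.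
by rewrite (linked_class_left i us kk2).
Qed.

(* Columns with the same left label but different right labels have disjoint
   supports, so blockwise orthonormality suffices. *)
Lemma label_orthonormal_mul a u s (F : 'M[C]_(N a, N u)) (X : 'M_(N u, N s)) :
  below u s -> supported X -> label_orthonormal F ->
  (forall k : 'I_(N s), isometrymx (lblock (class k) X)) ->
  label_orthonormal (F *m X).
Proof.
move=> us sX Forth Xorth k k' lkk'; have [uu ss] := (below_refl_l us, below_refl_r us).
have left_col (i : 'I_(N u)) (k1 : 'I_(N s)) :
    X i k1 != 0 -> left_label u i = left_label u k1 by move=> /sX/andP[/eqP].
have -> : ((F *m X)^t* *m (F *m X)) k k' = (X^t* *m X) k k'.
  rewrite trmxC_mul mulmxA -(mulmxA _ _ F) -[in RHS](mulmx1 (X^t*)) !mxE.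
  apply: eq_bigr => i' _; have [->|/left_col li'] := eqVneq (X i' k') 0.
    by rewrite !mulr0.
  congr (_ * _); rewrite !mxE; apply: eq_bigr => i _; rewrite !mxE.
  have [->|/left_col li] := eqVneq (X i k) 0; first by rewrite conjC0 !mul0r.
  congr (_ * _); rewrite -Forth ?mxE // li li'.
  by apply: left_label_coarsen lkk'.
have [kk'|nkk'] := boolP (linked s s k k').
  have := Xorth k; rewrite /isometrymx selectmx_gram // -[RHS](selectmx1 C).
  move=> /selectmx_eqP e.
  by rewrite e ?mxE // inE // linkedxx.
have /negPf -> : k != k' by apply: contra nkk' => /eqP ->; apply: linkedxx.
rewrite mxE big1 // => i _; rewrite !mxE.
have [->|/sX/andP[_ /eqP r]] := eqVneq (X i k) 0; first by rewrite conjC0 mul0r.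
have [->|/sX/andP[_ /eqP r']] := eqVneq (X i k') 0; first by rewrite mulr0.
by case/negP: nkk'; rewrite /linked /same_labels lkk' -r r' !eqxx.
Qed.

Lemma block_optimal_mull a u s b (F : 'M[C]_(N a, N u)) (M : 'M_(N u, N b))
    (X : 'M_(N u, N s)) (Y : 'M_(N s, N b)) :
  below a u -> below u s -> below s b ->
  supported F -> label_orthonormal F -> supported M -> supported X ->
  block_optimal M X Y -> block_optimal (F *m M) (F *m X) Y.
Proof.
move=> au us sb sF Forth sM sX best k P; have sa := below_trans au us.
have [aa uu] := (below_refl_l au, below_refl_r au).
have [ss bb] := (below_refl_r us, below_refl_r sb).
pose Fk := selectmx (rowset a P) (rowset u P) F.
have Fiso : isometrymx Fk.
  rewrite /isometrymx selectmx_adj -selectmx_mul => [|i r i']; last first.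
    rewrite !mem_rowset // => _ i'k _ /sF ri'; apply: (@linked_trans _ _ _ _ u _ _ i').
      exact: linked_coarsen ri'.
    exact: linked_coarsen i'k.
  rewrite -[RHS](selectmx1 C); apply/selectmx_eqP => i i'; rewrite !mem_rowset //.
  by move=> /andP[/eqP l _] /andP[/eqP l' _]; rewrite Forth ?mxE // l l'.
rewrite (@selectmx_mul _ _ _ _ _ (rowset u P)) => [|r i c]; last first.
  rewrite !mem_rowset // mem_colset // => rk /andP[/eqP lkc _] /sF ri /sM/andP[/eqP lic _].
  apply/andP; split; apply/eqP.
    by rewrite lic; apply/esym; apply: left_label_coarsen lkc.
  case/andP: ri rk => _ /eqP rri /andP[_ /eqP rrk]; rewrite -rrk; apply/esym.
  by apply: right_label_coarsen rri.
rewrite (@selectmx_mul _ _ _ _ _ (rowset u P)) => [|r i k'].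
  exact: best_lowrank_isometry Fiso (best k).
by rewrite !mem_rowset // inE => _ kk' _ /sX; rewrite (linked_class_left _ us kk').
Qed.

(* The optimal block approximations at [s] are left projections of the blocks,
   and these respect the coarser row blocks of any later cut [s']. *)
Lemma block_optimal_contract_left a s s' b (B : 'M[C]_(N a, N b)) (X : 'M_(N a, N s))
    (Y : 'M_(N s, N b)) (X1 : 'M_(N a, N s')) (Y1 : 'M_(N s', N b)) :
  below a s -> below s s' -> below s' b ->
  block_optimal B X Y -> supported X -> supported Y -> supported X1 -> supported Y1 ->
  exists2 X2 : 'M_(N a, N s'), supported X2 &
    normF2 (X *m Y - X2 *m Y1) <= normF2 (B - X1 *m Y1).
Proof.
move=> le_as ss' s'b best sX sY sX1 sY1.
have [sb as'] := (below_trans ss' s'b, below_trans le_as ss').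
have through (T : 'M[C]_(N a, N s')) (k : 'I_(N s)) : supported T ->
    block (class k) (T *m Y1) =
    block (class k) T *m selectmx (colset s' (class k)) (colset b (class k)) Y1.
  move=> sT; apply: selectmx_mul => i k' j; rewrite mem_rowset // !mem_colset //.
  move=> /andP[_ /eqP rik] /andP[/eqP lkj _] /sT/andP[_ /eqP rik'] /sY1/andP[/eqP lk'j _].
  apply/andP; split; apply/eqP.
    rewrite lkj; apply/esym; apply: left_label_coarsen lk'j => //; exact: below_refl_r ss'.
  rewrite -rik'; apply/esym; apply: right_label_coarsen rik => //; exact: below_refl_l ss'.
have [k|X2 sX2 X2E] := glue_blocks le_as ss' (good := fun P Z =>
    exists Q : 'M_(#|rowset a P|, #|P|),
    [/\ isometrymx Q, lblock P X *m rblock P Y = Q *m Q^t* *m block P B &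
        Z = Q *m Q^t* *m block P X1]).
  have [Q Qiso QB] := best_lowrank_projection (card_class_rowset k le_as) (best k).
  by exists (Q *m Q^t* *m block (class k) X1), Q.
exists X2 => //; apply: (normF2_le_blocks le_as sb) => [i j nl|k].
  have sXY := supported_mul le_as sb sX sY; have sXY2 := supported_mul as' s'b sX2 sY1.
  by rewrite mxE (supported_eq0 sXY nl) mxE (supported_eq0 sXY2 nl) subrr normr0.
have [Q [Qiso XYE ZE]] := X2E k.
rewrite selectmxB block_mul // XYE through // ZE -!mulmxA -!mulmxBr mulmxA.
rewrite -through // -selectmxB -mulmxA normF2_isometry //; exact: normF2_adj_isometry.
Qed.

End Transfer.

Section DualTransfer.
Variables (C : numClosedFieldType) (W : interface_system).
Local Notation N := (@idim W).
Implicit Types a b u s t : W.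

Lemma block_optimal_mulr u s t b (M : 'M[C]_(N u, N t)) (X : 'M_(N u, N s))
    (Y : 'M_(N s, N t)) (G : 'M_(N t, N b)) :
  below u s -> below s t -> below t b ->
  supported G -> @label_orthonormal C (dual_system W) b t G^T ->
  supported M -> supported Y ->
  block_optimal M X Y -> block_optimal (M *m G) X (Y *m G).
Proof.
move=> us st tb sG Gorth sM sY /block_optimal_dual best; apply/block_optimal_dual.
rewrite !trmx_mul; apply: (@block_optimal_mull C (dual_system W) b t s u) => //.
- exact/supported_dual.
- exact/supported_dual.
- exact/supported_dual.
Qed.

Lemma block_optimal_contract_right a s' s b (B : 'M[C]_(N a, N b)) (X : 'M_(N a, N s))
    (Y : 'M_(N s, N b)) (X1 : 'M_(N a, N s')) (Y1 : 'M_(N s', N b)) :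
  below a s' -> below s' s -> below s b ->
  block_optimal B X Y -> supported X -> supported Y -> supported X1 -> supported Y1 ->
  exists2 Y2 : 'M_(N s', N b), supported Y2 &
    normF2 (X *m Y - X1 *m Y2) <= normF2 (B - X1 *m Y1).
Proof.
move=> as' s's sb /block_optimal_dual best /supported_dual sX /supported_dual sY.
move=> /supported_dual sX1 /supported_dual sY1.
have [Y2 sY2 le] := @block_optimal_contract_left C (dual_system W) b s s' a
  B^T Y^T X^T Y1^T X1^T sb s's as' best sY sX sY1 sX1.
exists Y2^T; first by apply/supported_dual; rewrite trmxK.
by rewrite -normF2_trmx -(normF2_trmx (B - _)) !raddfB /= !trmx_mul trmxK.
Qed.

End DualTransfer.

(** * Distance to the products of two factors *)

Section Distance.
Variable R : realType.
Local Notation "x %:C" := (real_complex _ x) (format "x %:C") : ring_scope.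

Lemma sqr_frob m n (M : 'M[R[i]]_(m, n)) : (frob (MX M) ^+ 2)%:C = normF2 M.
Proof.
have ge0 : 0 <= \sum_(i < m) \sum_(j < n) cnorm (M i j) ^+ 2.
  by apply: sumr_ge0 => i _; apply: sumr_ge0 => j _; apply: sqr_ge0.
rewrite sqr_sqrtr // normF2E rmorph_sum; apply: eq_bigr => i _.
by rewrite rmorph_sum; apply: eq_bigr => j _; rewrite rmorphXn.
Qed.

Lemma frob_ge0 (A : mxs R) : 0 <= frob A.
Proof. exact: sqrtr_ge0. Qed.

Lemma ler_frob m n m' n' (M : 'M[R[i]]_(m, n)) (M' : 'M[R[i]]_(m', n')) :
  (frob (MX M) <= frob (MX M')) = (normF2 M <= normF2 M').
Proof. by rewrite -!sqr_frob lecR ler_sqr // nnegrE frob_ge0. Qed.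

Lemma frobD m n (M M' : 'M[R[i]]_(m, n)) :
  frob (MX (M + M')) <= frob (MX M) + frob (MX M').
Proof.
have frobC (P : 'M[R[i]]_(m, n)) : (frob (MX P))%:C = sqrtC (dotmx (mxvec P) (mxvec P)).
  have -> : dotmx (mxvec P) (mxvec P) = normF2 P.
    rewrite dotmxE mxE normF2E pair_big (reindex _ (curry_mxvec_bij m n)) /=.
    by apply: eq_bigr => -[i j] _; rewrite !mxE /= mxvecE normCK.
  by rewrite -sqr_frob rmorphXn sqrCK // lecR frob_ge0.
by rewrite -lecR rmorphD /= !frobC linearD; apply: (triangle_lerif (@dotmx _ _)).
Qed.

Variables (W : interface_system) (a b : W).
Local Notation N := (@idim W).
Implicit Types s : W.

Definition dist_products s (B : 'M[R[i]]_(N a, N b)) : R :=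
  inf [set x : R | exists (X : 'M_(N a, N s)) (Y : 'M_(N s, N b)),
    [/\ supported X, supported Y & x = frob (MX (B - X *m Y))]].

Lemma ge_dist_products s (B : 'M_(N a, N b)) (X : 'M_(N a, N s)) (Y : 'M_(N s, N b)) :
  supported X -> supported Y -> dist_products s B <= frob (MX (B - X *m Y)).
Proof.
move=> sX sY; apply: ge_inf; last by exists X, Y.
by exists 0 => _ [X1 [Y1 [_ _ ->]]]; apply: frob_ge0.
Qed.

Lemma le_dist_products s (B : 'M_(N a, N b)) x :
  (forall (X : 'M_(N a, N s)) (Y : 'M_(N s, N b)), supported X -> supported Y ->
    x <= frob (MX (B - X *m Y))) ->
  x <= dist_products s B.
Proof.
move=> lb; apply: lb_le_inf => [|_ [X [Y [sX sY ->]]]]; last exact: lb.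
exists (frob (MX (B - (0 : 'M_(N a, N s)) *m (0 : 'M_(N s, N b))))), 0, 0.
by split=> // i j; rewrite mxE eqxx.
Qed.

Lemma block_optimal_dist s (B : 'M_(N a, N b)) (X : 'M_(N a, N s)) (Y : 'M_(N s, N b)) :
  below a s -> below s b -> block_optimal B X Y -> supported X -> supported Y ->
  frob (MX (B - X *m Y)) <= dist_products s B.
Proof.
move=> a_s s_b best sX sY; apply: le_dist_products => X1 Y1 sX1 sY1.
by rewrite ler_frob; apply: block_optimal_le.
Qed.

Lemma dist_products_contract s s' (B : 'M_(N a, N b))
    (X : 'M_(N a, N s)) (Y : 'M_(N s, N b)) :
  below a s -> below s b -> below a s' -> below s' b -> below s s' \/ below s' s ->
  block_optimal B X Y -> supported X -> supported Y ->
  dist_products s' (X *m Y) <= dist_products s' B.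
Proof.
move=> a_s s_b a_s' s'_b ss' best sX sY; apply: le_dist_products => X1 Y1 sX1 sY1.
case: ss' => [ss'|s's].
  have [X2 sX2 le] := block_optimal_contract_left a_s ss' s'_b best sX sY sX1 sY1.
  by apply: le_trans (ge_dist_products _ sX2 sY1) _; rewrite ler_frob.
have [Y2 sY2 le] := block_optimal_contract_right a_s' s's s_b best sX sY sX1 sY1.
by apply: le_trans (ge_dist_products _ sX1 sY2) _; rewrite ler_frob.
Qed.

End Distance.

(** * The interfaces of an architecture *)

Local Open Scope nat_scope.

Lemma card_divn_modn (n w d a b : nat) : 0 < w -> d %| w -> b < d -> a.+1 * w <= n ->
  #|[set i : 'I_n | (i %/ w == a) && (i %% d == b)]| = w %/ d.
Proof.
move=> w_gt0 /dvdnP[q wE] bd run_le; have d_gt0 : 0 < d by apply: leq_ltn_trans bd.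
have q_gt0 : 0 < q by move: w_gt0; rewrite wE muln_gt0 => /andP[].
have lt_n (x : 'I_q) : a * w + (x * d + b) < n by have := ltn_ord x; nia.
rewrite wE mulnK // -wE -[RHS]card_ord.
rewrite -(card_imset _ (f := fun x => Ordinal (lt_n x))); last first.
  by move=> x y /(congr1 val) /= e; apply: val_inj => /=; nia.
apply: eq_card => i; rewrite !inE; apply/andP/imsetP => [[/eqP ia /eqP ib]|[x _ ->]] /=.
  have iE : nat_of_ord i = a * w + (i %% w %/ d * d + b).
    rewrite {1}(divn_eq i w) ia {1}(divn_eq (i %% w) d) modn_dvdm ?ib //.
    by rewrite wE dvdn_mull.
  have xq : i %% w %/ d < q by rewrite ltn_divLR // -wE ltn_mod.
  by exists (Ordinal xq) => //; apply: val_inj; rewrite /= -iE.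
have lt_w : x * d + b < w by have := ltn_ord x; nia.
by rewrite divnMDl // divn_small // addn0 addnA wE mulnA -mulnDl modnMDl modn_small // !eqxx.
Qed.

(* The left labels at [u] split the indices of an interface [v >= u] into
   [nleft u] runs of equal length, and the right labels at [t >= v] are their
   residues modulo [nright t]. *)
Record grid_dims (L : nat) (dim nleft nright : nat -> nat) : Prop := GridDims {
  dim_gt0 : forall u, u <= L -> 0 < dim u;
  nleft_nright_dvd : forall u, u <= L -> nleft u * nright u %| dim u;
  nleft_dvd : forall u v, u <= v <= L -> nleft u %| nleft v;
  nright_dvd : forall u v, u <= v <= L -> nright v %| nright u;
  left_width_mono : forall u v, u <= v <= L -> dim v %/ nleft v <= dim u %/ nleft u;
  right_width_mono : forall u v, u <= v <= L -> dim u %/ nright u <= dim v %/ nright v }.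

Section Grid.
Variables (L : nat) (dim nleft nright : nat -> nat).
Hypothesis grid : grid_dims L dim nleft nright.

Definition width u v := dim v %/ nleft u.

Lemma nleft_dvd_dim u v : u <= v <= L -> nleft u %| dim v.
Proof.
move=> uv; apply: dvdn_trans (nleft_dvd grid uv) _; case/andP: uv => _ vL.
exact: dvdn_trans (dvdn_mulr _ _) (nleft_nright_dvd grid vL).
Qed.

Lemma nleft_gt0 u : u <= L -> 0 < nleft u.
Proof.
move=> uL; apply: (dvdn_gt0 (dim_gt0 grid uL)).
exact: dvdn_trans (dvdn_mulr _ _) (nleft_nright_dvd grid uL).
Qed.

Lemma nright_gt0 u : u <= L -> 0 < nright u.
Proof.
move=> uL; apply: (dvdn_gt0 (dim_gt0 grid uL)).
exact: dvdn_trans (dvdn_mull _ _) (nleft_nright_dvd grid uL).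
Qed.

Lemma mul_nleft_width u v : u <= v <= L -> nleft u * width u v = dim v.
Proof. by move=> uv; rewrite mulnC divnK // nleft_dvd_dim. Qed.

Lemma width_gt0 u v : u <= v <= L -> 0 < width u v.
Proof.
move=> uv; have /andP[_ vL] := uv; have := dim_gt0 grid vL.
by rewrite -(mul_nleft_width uv) muln_gt0 => /andP[].
Qed.

Lemma width_split u u' v : u <= u' -> u' <= v <= L ->
  width u v = width u' v * (nleft u' %/ nleft u).
Proof.
move=> uu' /andP[u'v vL]; have u'L := leq_trans u'v vL.
have dvd : nleft u %| nleft u' by apply: (nleft_dvd grid); rewrite uu'.
rewrite {1}/width -(@mul_nleft_width u' v) ?u'v // -{1}(divnK dvd) mulnAC.
rewrite mulnK 1?mulnC //.
by rewrite nleft_gt0 // (leq_trans uu').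
Qed.

Lemma nright_dvd_width u v t : u <= v <= L -> v <= t <= L -> nright t %| width u v.
Proof.
move=> /andP[uv vL] vt; apply: dvdn_trans (nright_dvd grid vt) _.
rewrite (width_split uv) ?leqnn // dvdn_mulr // dvdn_divRL ?nleft_dvd_dim ?leqnn //.
by rewrite mulnC (nleft_nright_dvd grid).
Qed.

Lemma divn_width_lt u v (i : 'I_(dim v)) : u <= v <= L -> i %/ width u v < nleft u.
Proof. by move=> uv; rewrite ltn_divLR ?width_gt0 // mul_nleft_width. Qed.

Lemma divn_width_coarsen u u' v w i j : u <= u' <= L -> u' <= v <= L -> u' <= w <= L ->
  i %/ width u' v = j %/ width u' w -> i %/ width u v = j %/ width u w.
Proof.
by move=> /andP[uu' _] u'v u'w e; rewrite !(width_split uu') // !divnMA e.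
Qed.

Lemma modn_nright_coarsen t t' i j : t' <= t <= L ->
  i = j %[mod nright t'] -> i = j %[mod nright t].
Proof.
by move=> /(nright_dvd grid) dvd e; rewrite -(modn_dvdm i dvd) e modn_dvdm.
Qed.

Lemma div_mod_realized u v t x y : u <= v <= L -> v <= t <= L ->
  x < nleft u -> y < nright t ->
  exists k : 'I_(dim v), k %/ width u v = x /\ k %% nright t = y.
Proof.
move=> uv vt xlt ylt; have dvd := nright_dvd_width uv vt.
have w_gt0 := width_gt0 uv; have yw : y < width u v := leq_trans ylt (dvdn_leq w_gt0 dvd).
have klt : x * width u v + y < dim v by rewrite -(mul_nleft_width uv); nia.
exists (Ordinal klt) => /=; split; first by rewrite divnMDl // divn_small // addn0.
by rewrite -modnDml (eqP (dvdn_mull _ dvd)) add0n modn_small.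
Qed.

Lemma card_div_mod u v t x y : u <= v <= L -> v <= t <= L ->
  x < nleft u -> y < nright t ->
  #|[set i : 'I_(dim v) | (i %/ width u v == x) && (i %% nright t == y)]| =
  width u v %/ nright t.
Proof.
move=> uv vt xlt ylt; apply: card_divn_modn => //; first exact: width_gt0.
  exact: nright_dvd_width.
by rewrite -(mul_nleft_width uv) leq_mul2r xlt orbT.
Qed.

#[local] Obligation Tactic := idtac.

Program Definition grid_system : interface_system :=
  @InterfaceSystem nat (fun u v => u <= v <= L) dim
    (fun u v i => i %/ width u v) (fun t v i => i %% nright t) _ _ _ _ _ _ _ _.
Next Obligation. by move=> u v /andP[uv /(leq_trans uv)]; rewrite leqnn. Qed.
Next Obligation. by move=> u v /andP[_]; rewrite leqnn. Qed.
Next Obligation. by move=> u v w /andP[uv _] /andP[vw ->]; rewrite (leq_trans uv). Qed.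
Next Obligation. by move=> u u' v w i j uu' u'v u'w; apply: divn_width_coarsen. Qed.
Next Obligation. by move=> t t' v w i j t't _ _; apply: modn_nright_coarsen. Qed.
Next Obligation.
move=> u v t w w' i j uv vt uw /andP[_ tL].
by apply: div_mod_realized; rewrite ?divn_width_lt // ltn_mod nright_gt0.
Qed.
Next Obligation.
move=> u s k us; have /andP[us' sL] := us; have uL := leq_trans us' sL.
rewrite !card_div_mod ?divn_width_lt ?ltn_mod ?nright_gt0 ?leqnn //.
exact: leq_div2r (left_width_mono grid us).
Qed.
Next Obligation.
move=> s t k st; have /andP[st' tL] := st; have sL := leq_trans st' tL.
rewrite !card_div_mod ?divn_width_lt ?ltn_mod ?nright_gt0 ?leqnn //.
rewrite /width -!divnMA ![nleft s * _]mulnC !divnMA.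
exact: leq_div2r (right_width_mono grid st).
Qed.

End Grid.

Section Architecture.
Variable beta : seq pattern.
Local Notation L := (size beta).
Local Notation p := (pat beta).

Definition arch_dim u := if u is 0 then prows (p 1) else pcols (p u).
Definition arch_nleft u := if u < L then pa (p u.+1) else pa (p L) * pc (p L).
Definition arch_nright u := if u is 0 then pb (p 1) * pd (p 1) else pd (p u).

Definition butterfly_arch : Prop :=
  [/\ 0 < L, is_arch beta, chainable_arch beta & ~ redundant_arch beta].

Hypothesis beta_arch : butterfly_arch.
Let L_gt0 : 0 < L. Proof. by case: beta_arch. Qed.
Let arch : is_arch beta. Proof. by case: beta_arch. Qed.
Let chain : chainable_arch beta. Proof. by case: beta_arch. Qed.
Let nonredundant : ~ redundant_arch beta. Proof. by case: beta_arch. Qed.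

Lemma pat_gt0 l : 1 <= l <= L ->
  [/\ 0 < pa (p l), 0 < pb (p l), 0 < pc (p l) & 0 < pd (p l)].
Proof.
case: arch => /(all_nthP (Pat 1 1 1 1)) pos _ /andP[l0 lL].
have : l.-1 < L by rewrite prednK.
by move/pos => /and4P.
Qed.

Lemma arch_dim_rows u : u < L -> arch_dim u = pa (p u.+1) * pb (p u.+1) * pd (p u.+1).
Proof. by case: u => [//|u] uL; rewrite /arch_dim /pcols; case: arch => _; apply. Qed.

Lemma chain_ratio l : 1 <= l < L -> exists r,
  [/\ pa (p l) * pc (p l) = r * pa (p l.+1), pb (p l.+1) * pd (p l.+1) = r * pd (p l),
      r < pb (p l) & r < pc (p l.+1)].
Proof.
move=> lL; have [d1 d2 e _ _] := chain lL; pose r := Defs.ratio (p l) (p l.+1).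
have : r < minn (pb (p l)) (pc (p l.+1)).
  by rewrite ltnNge; apply/negP => r_ge; apply: nonredundant; exists l.
rewrite leq_min => /andP[rb rc]; exists r; split=> //; first by rewrite divnK.
by rewrite /r /Defs.ratio e divnK.
Qed.

Lemma arch_width_left u : u < L -> arch_dim u %/ arch_nleft u = pb (p u.+1) * pd (p u.+1).
Proof.
move=> uL; rewrite arch_dim_rows // /arch_nleft uL -mulnA mulKn //.
by have [] := @pat_gt0 u.+1.
Qed.

Lemma arch_width_right u : 0 < u <= L -> arch_dim u %/ arch_nright u = pa (p u) * pc (p u).
Proof. by case: u => // u uL; rewrite /= mulnK //; have [] := @pat_gt0 u.+1. Qed.

Lemma arch_nleft_nright_dvd u : u <= L -> arch_nleft u * arch_nright u %| arch_dim u.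
Proof.
rewrite /arch_nleft leq_eqVlt => /predU1P[->|uL].
  by rewrite ltnn; case: L L_gt0.
rewrite uL; case: u uL => [|u] uL /=; first by rewrite mulnA.
by rewrite dvdn_mul //; have [] := @chain u.+1 uL.
Qed.

Lemma arch_left_width_step u : u < L ->
  arch_dim u.+1 %/ arch_nleft u.+1 <= arch_dim u %/ arch_nleft u.
Proof.
move=> uL; rewrite (arch_width_left uL); have [u1L|] := ltnP u.+1 L.
  rewrite arch_width_left //; have [r [_ -> rb _]] := @chain_ratio u.+1 u1L.
  by rewrite leq_mul2r (ltnW rb) orbT.
move=> Lu; have uE : u.+1 = L by apply/eqP; rewrite eqn_leq uL.
have [a_gt0 b_gt0 c_gt0 _] := @pat_gt0 u.+1 uL.
by rewrite /arch_nleft -uE ltnn /= /pcols mulKn ?muln_gt0 ?a_gt0 // leq_pmull.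
Qed.

Lemma arch_right_width_step u : u < L ->
  arch_dim u %/ arch_nright u <= arch_dim u.+1 %/ arch_nright u.+1.
Proof.
move=> uL; rewrite (@arch_width_right u.+1) //; case: u uL => [|u] uL.
  have [_ b_gt0 c_gt0 d_gt0] := @pat_gt0 1 uL.
  by rewrite /= /prows -mulnA mulnK ?muln_gt0 ?b_gt0 // leq_pmulr.
rewrite (@arch_width_right u.+1) ?(ltnW uL) //.
have [r [-> _ _ rc]] := @chain_ratio u.+1 uL.
by rewrite mulnC leq_mul2l (ltnW rc) orbT.
Qed.

Lemma homo_upto (r : nat -> nat -> Prop) (f : nat -> nat) :
  (forall x, r x x) -> (forall y x z, r x y -> r y z -> r x z) ->
  (forall u, u < L -> r (f u) (f u.+1)) -> forall u v, u <= v <= L -> r (f u) (f v).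
Proof.
move=> rr rt step u v /andP[uv vL].
apply: (@homo_leq_in _ [pred u | u <= L] f r) => // [i j iL jL k /andP[_ kj]|i _|].
- exact: leq_trans (ltnW kj) jL.
- exact: step.
- exact: leq_trans uv vL.
Qed.

Lemma arch_grid : grid_dims L arch_dim arch_nleft arch_nright.
Proof.
split.
- case=> [|u] uL; rewrite /= /prows /pcols.
    by have [a0 b0 _ d0] := @pat_gt0 1 L_gt0; rewrite !muln_gt0 a0 b0.
  by have [a0 _ c0 d0] := @pat_gt0 u.+1 uL; rewrite !muln_gt0 a0 c0.
- exact: arch_nleft_nright_dvd.
- apply: (homo_upto (r := fun x y => x %| y)) => [//|y x z|u uL]; first exact: dvdn_trans.
  rewrite /arch_nleft uL; case: ifP => [u1L|/negbT].
    by have [] := @chain u.+1 u1L.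
  by rewrite -leqNgt => Lu; rewrite (_ : L = u.+1) ?dvdn_mulr //; lia.
- apply: (homo_upto (r := fun x y => y %| x)) => [//|y x z xy yz|[|u] uL] /=.
  + exact: dvdn_trans yz xy.
  + exact: dvdn_mull.
  + by have [] := @chain u.+1 uL.
- apply: (homo_upto (r := fun x y => y <= x) (f := fun u => arch_dim u %/ arch_nleft u)).
  + exact: leqnn.
  + by move=> y x z xy yz; apply: leq_trans yz xy.
  + exact: arch_left_width_step.
- apply: (homo_upto (r := fun x y => x <= y) (f := fun u => arch_dim u %/ arch_nright u)).
  + exact: leqnn.
  + exact: leq_trans.
  + exact: arch_right_width_step.
Qed.

Definition arch_system : interface_system := grid_system arch_grid.

Lemma below_archE (u v : arch_system) : below u v = (u <= v <= L).
Proof. by []. Qed.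

Lemma prodpatE u t : u < t <= L ->
  prodpat beta u.+1 t =
  Pat (arch_nleft u) (arch_dim u %/ arch_nleft u %/ arch_nright t)
      (arch_dim t %/ arch_nleft u %/ arch_nright t) (arch_nright t).
Proof.
move=> /andP[]; elim: t => // t IH; rewrite ltnS => ut tL.
have uL := leq_ltn_trans ut tL; have [a0 b0 c0 d0] := @pat_gt0 t.+1 tL.
have := ut; rewrite leq_eqVlt => /predU1P[e|lt].
  rewrite e in uL *; rewrite /prodpat subnn /= arch_width_left // /arch_nleft uL mulnK //.
  by rewrite /pcols -mulnA mulKn // mulnK //; case: (p t.+1).
have -> : prodpat beta u.+1 t.+1 = pat_mul (prodpat beta u.+1 t) (p t.+1).
  rewrite /prodpat subSn // -[(t - u.+1).+1]addn1 iotaD foldl_cat /=.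
  by congr (pat_mul _ (p _)); lia.
rewrite IH ?(ltnW tL) // /pat_mul /=; congr Pat.
- by rewrite divnK //; apply: (nright_dvd_width arch_grid); lia.
- by rewrite /pcols -divnMA [arch_nleft u * _]mulnC divnMA mulnK.
Qed.

Lemma prows_prodpat u t : u < t <= L -> prows (prodpat beta u.+1 t) = arch_dim u.
Proof.
move=> utL; rewrite prodpatE // /prows /= -mulnA divnK.
  by apply: (mul_nleft_width arch_grid); lia.
by apply: (nright_dvd_width arch_grid); lia.
Qed.

Lemma pcols_prodpat u t : u < t <= L -> pcols (prodpat beta u.+1 t) = arch_dim t.
Proof.
move=> utL; rewrite prodpatE // /pcols /= -mulnA divnK.
  by apply: (mul_nleft_width arch_grid); lia.
by apply: (nright_dvd_width arch_grid); lia.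
Qed.

Lemma supp_prodpat u t (i : 'I_(arch_dim u)) (j : 'I_(arch_dim t)) : u < t <= L ->
  supp (prodpat beta u.+1 t) i j = @linked arch_system u t u t i j.
Proof.
by move=> utL; rewrite prodpatE // /supp /= !divnK //; apply: (nright_dvd_width arch_grid); lia.
Qed.

Section Classes.
Variables u s t : nat.
Hypotheses (us : u < s) (st : s < t) (tL : t <= L).
Local Notation q1 := (prodpat beta u.+1 s).
Local Notation q2 := (prodpat beta s.+1 t).
Local Notation linked := (@linked arch_system).

Let usL : u < s <= L. Proof. by lia. Qed.
Let stL : s < t <= L. Proof. by lia. Qed.
Let below_us : @below arch_system u s. Proof. by rewrite below_archE; lia. Qed.
Let below_st : @below arch_system s t. Proof. by rewrite below_archE; lia. Qed.
Implicit Types (k : 'I_(arch_dim s)) (r : 'I_(arch_dim u)) (c : 'I_(arch_dim t)).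

Lemma Uent_linked k r c : Uent q1 q2 k r c = linked u s r k && linked s t k c.
Proof. by rewrite /Uent prows_prodpat // pcols_prodpat // !ltn_ord !supp_prodpat. Qed.

Lemma inRP_linked k r : inRP q1 q2 k r = linked u s r k.
Proof.
rewrite /inRP pcols_prodpat //; apply/existsP/idP => [[c]|rk].
  by rewrite Uent_linked => /andP[].
by have [c kc] := linked_right_exists below_st k; exists c; rewrite Uent_linked rk.
Qed.

Lemma inCP_linked k c : inCP q1 q2 k c = linked s t k c.
Proof.
rewrite /inCP prows_prodpat //; apply/existsP/idP => [[r]|kc].
  by rewrite Uent_linked => /andP[].
by have [r rk] := linked_left_exists below_us k; exists r; rewrite Uent_linked rk.
Qed.

Lemma inP_class k k' : inP q1 q2 k k' = (k' \in @class arch_system s k).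
Proof.
rewrite /inP /sameU pcols_prodpat // prows_prodpat // pcols_prodpat // ltn_ord /= inE.
apply/forallP/idP => [same|kk' r].
  have [c kc] := linked_right_exists below_st k.
  have [r rk] := linked_left_exists below_us k.
  have := forallP (same r) c; rewrite !Uent_linked rk kc => /eqP/esym k'_rc.
  have : k' \in @midclass arch_system u s t r c by rewrite inE k'_rc.
  by rewrite (midclassE below_us below_st rk kc) inE.
apply/forallP => c; rewrite !Uent_linked.
rewrite (@linked_class_left arch_system u s k k' r below_us kk').
by rewrite (@linked_class_right arch_system s t k k' c below_st kk').
Qed.

End Classes.
End Architecture.

(** * Factors, two-factor approximations and orthonormalizations as matrices *)

Local Open Scope ring_scope.
Local Open Scope sesquilinear_scope.

Section MatricesOfFunctions.
Variable R : realType.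
Local Notation C := R[i].

Definition funmx m n (f : nat -> nat -> C) : 'M[C]_(m, n) := \matrix_(i, j) f i j.

Definition tomx m n (X : mxs R) : 'M[C]_(m, n) := funmx m n (ent X).

Lemma ent_MX m n (M : 'M[C]_(m, n)) (i : 'I_m) (j : 'I_n) : ent (MX M) i j = M i j.
Proof. by rewrite /ent /= !valK. Qed.

Lemma funmx_ent m n (M : 'M[C]_(m, n)) : funmx m n (ent (MX M)) = M.
Proof. by apply/matrixP => i j; rewrite mxE ent_MX. Qed.

Lemma ent_neq0 (X : mxs R) i j : ent X i j != 0 -> (i < nr X)%N /\ (j < nc X)%N.
Proof.
rewrite /ent; case: insubP => [i' ? _|]; last by rewrite eqxx.
by case: insubP => [j' ? _|]; last by rewrite eqxx.
Qed.

Lemma tomx_mulx m n p (X Y : mxs R) : nc X = n ->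
  tomx m p (mulx X Y) = tomx m n X *m tomx n p Y.
Proof.
move=> <-; apply/matrixP => i j; rewrite !mxE.
under eq_bigr do rewrite !mxE.
have [[iX jY]|out] := pselect ((i < nr X)%N /\ (j < nc Y)%N); last first.
  have -> : ent (mulx X Y) i j = 0 by apply/eqP; apply: contra_notT out => /ent_neq0.
  rewrite big1 // => k _; apply/eqP; apply: contra_notT out; rewrite mulf_eq0 negb_or.
  by move=> /andP[/ent_neq0[iX _] /ent_neq0[_ jY]].
rewrite (ent_MX _ (Ordinal iX) (Ordinal jY)) mxE; apply: eq_bigr => k _.
by rewrite -ent_MX; case: X k iX.
Qed.

Lemma frob_subx m n (X Y : mxs R) : nr X = m -> nc X = n ->
  frob (subx X Y) = frob (MX (tomx m n X - tomx m n Y)).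
Proof.
move=> <- <-; congr (frob (MX _)); apply/matrixP => i j; rewrite !mxE; congr (_ - _).
by rewrite -ent_MX; case: X i j.
Qed.

Lemma ltn_enum_val n (A : {set 'I_n}) (x y : 'I_#|A|) :
  (enum_val x < enum_val y)%N = (x < y)%N.
Proof.
have ltn_tr : transitive (relpre val ltn : rel 'I_n) by move=> ? ? ?; apply: ltn_trans.
have enum_sorted : sorted (relpre val ltn) (enum A).
  rewrite -sorted_map {1}/enum_mem -enumT.
  apply: (subseq_sorted ltn_trans (map_subseq _ (filter_subseq _ _))).
  by rewrite val_enum_ord iota_ltn_sorted.
have incr (x' y' : 'I_#|A|) : (x' < y')%N -> (enum_val x' < enum_val y')%N.
  have := sorted_ltn_nth ltn_tr (enum_val x') enum_sorted x' y'.
  by rewrite !inE -!cardE !ltn_ord -!enum_val_nth; apply.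
case: (ltngtP x y) => [/incr //|/incr yx|/val_inj ->]; last by rewrite ltnn.
by rewrite ltnNge ltnW.
Qed.

Definition enumerated_by m (A : {set 'I_m}) (a : pred nat) :=
  forall r : nat, reflect (exists x : 'I_#|A|, r = enum_val x) (a r).

Lemma enumerated_byP m (A : {set 'I_m}) (a : pred nat) :
  (forall r, a r -> r < m)%N -> (forall r : 'I_m, a r = (r \in A)) -> enumerated_by A a.
Proof.
move=> a_lt aA r; apply: (iffP idP) => [ar|[x ->]]; last by rewrite aA enum_valP.
have rA : Ordinal (a_lt r ar) \in A by rewrite -aA.
by exists (enum_rank_in rA (Ordinal (a_lt r ar))); rewrite enum_rankK_in.
Qed.

Lemma big_enumerated (V : nmodType) m (A : {set 'I_m}) (a : pred nat) (F : nat -> V) :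
  enumerated_by A a -> \sum_(r < m | a r) F r = \sum_(x < #|A|) F (enum_val x).
Proof.
move=> aP; rewrite -[RHS](big_enum_val (fun i : 'I_m => F i)); apply: eq_bigl => r.
apply/aP/idP => [[x /val_inj ->]|rA]; first exact: enum_valP.
by exists (enum_rank_in rA r); rewrite enum_rankK_in.
Qed.

(* The block [Q R] decomposition of [ortho], whose factors are functions of the
   indices of the whole matrices. *)
Lemma block_qr_funP m n p (A : {set 'I_m}) (P : {set 'I_n}) (D : {set 'I_p})
    (a b d : pred nat) (X X' Y Y' : nat -> nat -> C) :
  enumerated_by A a -> enumerated_by P b -> enumerated_by D d ->
  (exists2 Rm : 'M_#|P|,
     qr_decomposition (selectmx A P (funmx m n X)) (selectmx A P (funmx m n X')) Rm &
     selectmx P D (funmx n p Y') = Rm *m selectmx P D (funmx n p Y)) <->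
  (exists Q Rm : nat -> nat -> C,
     (forall j j', b j -> b j' -> (j' < j)%N -> Rm j j' = 0) /\
     [/\ forall j j', b j -> b j' ->
           \sum_(r < m | a r) conjc (Q r j) * Q r j' = (j == j')%:R,
         forall r j, a r -> b j -> X r j = \sum_(j' < n | b j') Q r j' * Rm j' j,
         forall r j, a r -> b j -> X' r j = Q r j &
         forall j c, b j -> d c -> Y' j c = \sum_(j' < n | b j') Rm j j' * Y j' c]).
Proof.
move=> aP bP dP; have ax (x : 'I_#|A|) : a (enum_val x : 'I_m) by apply/aP; exists x.
have bx (x : 'I_#|P|) : b (enum_val x : 'I_n) by apply/bP; exists x.
have dx (x : 'I_#|D|) : d (enum_val x : 'I_p) by apply/dP; exists x.
split=> [[Rm [X'iso Rup XE] YE]|[Qf [Rf [Rup [Qiso XE X'E YE]]]]].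
  pose Rf := ent (MX (extendmx Rm)).
  have RfE (x y : 'I_#|P|) : Rf (enum_val x : 'I_n) (enum_val y : 'I_n) = Rm x y.
    by rewrite /Rf ent_MX extendmxE.
  exists X', Rf; split=> [_ _ /bP[x ->] /bP[y ->]|].
    by rewrite RfE ltn_enum_val; apply: Rup.
  split=> [_ _ /bP[x ->] /bP[y ->]|_ _ /aP[x ->] /bP[y ->]|//|_ _ /bP[x ->] /dP[y ->]].
  - rewrite (big_enumerated (fun r => conjc (X' r _) * X' r _) aP) val_eqE.
    have /matrixP/(_ x y) := X'iso; rewrite !mxE (inj_eq enum_val_inj) => <-.
    by apply: eq_bigr => z _; rewrite !mxE.
  - rewrite (big_enumerated (fun j => X' _ j * Rf j _) bP).
    have /matrixP/(_ x y) := XE; rewrite !mxE => ->.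
    by apply: eq_bigr => z _; rewrite !mxE RfE.
  - rewrite (big_enumerated (fun j => Rf _ j * Y j _) bP).
    have /matrixP/(_ x y) := YE; rewrite !mxE => ->.
    by apply: eq_bigr => z _; rewrite !mxE RfE.
exists (selectmx P P (funmx n n Rf)); first split.
- apply/matrixP => x y; rewrite !mxE -(inj_eq enum_val_inj) -val_eqE -(Qiso _ _ (bx x) (bx y)).
  rewrite (big_enumerated (fun r => conjc (Qf r _) * Qf r _) aP).
  by apply: eq_bigr => z _; rewrite !mxE !X'E.
- by move=> x y yx; rewrite !mxE Rup // ltn_enum_val.
- apply/matrixP => x y; rewrite !mxE XE // (big_enumerated (fun j => Qf _ j * Rf j _) bP).
  by apply: eq_bigr => z _; rewrite !mxE X'E.
- apply/matrixP => x y; rewrite !mxE YE // (big_enumerated (fun j => Rf _ j * Y j _) bP).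
  by apply: eq_bigr => z _; rewrite !mxE.
Qed.

End MatricesOfFunctions.

Section ArchitectureFactors.
Variables (R : realType) (beta : seq pattern).
Local Notation C := R[i].
Local Notation L := (size beta).
Local Notation N := (arch_dim beta).
Local Notation mx u t X := (tomx (N u) (N t) X).
Hypothesis beta_arch : butterfly_arch beta.
Local Notation W := (arch_system beta_arch).

Definition factor_between u t (X : mxs R) :=
  [/\ nr X = N u, nc X = N t & @supported W C u t (mx u t X)].

Lemma factor_MX u t (M : 'M[C]_(N u, N t)) :
  @supported W C u t M -> factor_between u t (MX M).
Proof. by move=> sM; split=> //; rewrite [mx _ _ _]funmx_ent. Qed.

Lemma is_factorE u t (X : mxs R) : (u < t <= L)%N ->
  is_factor (prodpat beta u.+1 t) X <-> factor_between u t X.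
Proof.
move=> utL; rewrite /is_factor prows_prodpat // pcols_prodpat //.
split=> -[rX cX]; case: X rX cX => m n M /= rX cX; subst m n => supX; split=> // i j.
  by rewrite mxE ent_MX; apply: contraNT => nij; apply/eqP/supX; rewrite supp_prodpat.
rewrite [mx _ _ _]funmx_ent in supX; rewrite supp_prodpat //.
exact: (@supported_eq0 W C u t M i j supX).
Qed.

Section Pair.
Variables u s t : nat.
Hypotheses (us : (u < s)%N) (st : (s < t)%N) (tL : (t <= L)%N).
Local Notation q1 := (prodpat beta u.+1 s).
Local Notation q2 := (prodpat beta s.+1 t).
Implicit Types k : 'I_(N s).
Let usL : (u < s <= L)%N. Proof. by lia. Qed.
Let stL : (s < t <= L)%N. Proof. by lia. Qed.
Let below_us : @below W u s. Proof. by rewrite below_archE; lia. Qed.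
Let below_st : @below W s t. Proof. by rewrite below_archE; lia. Qed.
Let rows1 : prows q1 = N u. Proof. exact: prows_prodpat. Qed.
Let cols1 : pcols q1 = N s. Proof. exact: pcols_prodpat. Qed.
Let cols2 : pcols q2 = N t. Proof. exact: pcols_prodpat. Qed.

Local Notation RP k := (@rowset W u s (@class W s k)).
Local Notation CP k := (@colset W s t (@class W s k)).

Lemma inRP_rowset k (r : 'I_(N u)) : inRP q1 q2 k r = (r \in RP k).
Proof. by rewrite (@mem_rowset W u s k r) //; apply: inRP_linked. Qed.

Lemma inCP_colset k (c : 'I_(N t)) : inCP q1 q2 k c = (c \in CP k).
Proof. by rewrite (@mem_colset W s t k c) //; apply: inCP_linked. Qed.

Lemma inRP_enumerates k : enumerated_by (RP k) (inRP q1 q2 k).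
Proof.
apply: enumerated_byP => [r|r]; last exact: inRP_rowset.
by case/existsP => c /and3P[]; rewrite rows1.
Qed.

Lemma inCP_enumerates k : enumerated_by (CP k) (inCP q1 q2 k).
Proof.
apply: enumerated_byP => [c|c]; last exact: inCP_colset.
by case/existsP => r /and4P[_ _]; rewrite cols2.
Qed.

Lemma inP_enumerates k : enumerated_by (@class W s k) (inP q1 q2 k).
Proof.
apply: enumerated_byP => [j|j]; last exact: inP_class.
by case/andP; rewrite cols1.
Qed.

Lemma block_supportedE (X Y : mxs R) :
  block_supported q1 q2 X Y <-> factor_between u s X /\ factor_between s t Y.
Proof.
rewrite /block_supported rows1 cols1 cols2 (prows_prodpat beta_arch stL) //.
split=> [[[rX cX] [rY cY] hX hY]|[[rX cX sX] [rY cY sY]]].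
  split; split=> // i j; rewrite mxE; apply: contraNT => nl; apply/eqP.
    by apply: hX; rewrite inRP_rowset (@mem_rowset W u s j i).
  by apply: hY; rewrite inCP_colset (@mem_colset W s t i j).
rewrite rX cX rY cY; split=> // i j; apply: contraNeq => /[dup] nz /ent_neq0[iN jN].
  rewrite rX in iN; rewrite cX in jN; rewrite (inRP_rowset (Ordinal jN) (Ordinal iN)).
  by rewrite (@mem_rowset W u s (Ordinal jN) (Ordinal iN)) //; apply: sX; rewrite mxE.
rewrite rY in iN; rewrite cY in jN; rewrite (inCP_colset (Ordinal iN) (Ordinal jN)).
by rewrite (@mem_colset W s t (Ordinal iN) (Ordinal jN)) //; apply: sY; rewrite mxE.
Qed.

Lemma blockerrE (M : mxs R) k (H K : nat -> nat -> C) :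
  blockerr q1 q2 M k H K =
  frob (MX (selectmx (RP k) (CP k) (mx u t M) -
            selectmx (RP k) (@class W s k) (funmx (N u) (N s) H) *m
            selectmx (@class W s k) (CP k) (funmx (N s) (N t) K))).
Proof.
rewrite /blockerr /frob /=; congr Num.sqrt.
rewrite rows1 cols1 cols2 (big_enumerated (fun r => \sum_(c < N t | inCP q1 q2 k c)
  cnorm (ent M r c - \sum_(j < N s | inP q1 q2 k j) H r j * K j c) ^+ 2) (inRP_enumerates k)).
apply: eq_bigr => x _; rewrite (big_enumerated (fun c =>
  cnorm (ent M _ c - \sum_(j < N s | inP q1 q2 k j) H _ j * K j c) ^+ 2) (inCP_enumerates k)).
apply: eq_bigr => y _.
rewrite (big_enumerated (fun j => H _ j * K j _) (inP_enumerates k)) !mxE.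
by congr (cnorm (_ - _) ^+ 2); apply: eq_bigr => z _; rewrite !mxE.
Qed.

Lemma twofactorE (M X Y : mxs R) : twofactor q1 q2 M X Y <->
  [/\ factor_between u s X, factor_between s t Y &
      @block_optimal C W u s t (mx u t M) (mx u s X) (mx s t Y)].
Proof.
rewrite /twofactor block_supportedE cols1; split=> [[[fX fY] best]|[fX fY best]].
  split=> // k P H K.
  have := best k (ltn_ord k) (ent (MX (extendmx H))) (ent (MX (extendmx K))).
  by rewrite !blockerrE !funmx_ent !extendmxK ler_frob.
split=> // i iN H K; rewrite !(blockerrE _ (Ordinal iN)) ler_frob.
exact: best.
Qed.

Lemma twofactor_exists (M : mxs R) : exists X Y, twofactor q1 q2 M X Y.
Proof.
have [X [Y [sX sY best]]] := block_optimal_exists below_us below_st (mx u t M).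
exists (MX X), (MX Y); apply/twofactorE; split; try exact: factor_MX.
by rewrite /tomx !funmx_ent.
Qed.

Lemma ortho_colE (X Y X' Y' : mxs R) : Defs.ortho OCol q1 q2 X Y X' Y' <->
  [/\ factor_between u s X', factor_between s t Y' &
      @block_qr C W u s t (mx u s X) (mx s t Y) (mx u s X') (mx s t Y')].
Proof.
rewrite /Defs.ortho block_supportedE rows1 cols1.
have qrP k := block_qr_funP (ent X) (ent X') (ent Y) (ent Y')
  (inRP_enumerates k) (inP_enumerates k) (inCP_enumerates k).
split=> [[[fX' fY'] qr]|[fX' fY' [_ _ qr]]]; split=> //.
  by split; [case: fX'|case: fY'|move=> k; apply/qrP/qr].
by move=> i iN; apply/(qrP (Ordinal iN))/qr.
Qed.

Lemma ortho_rowE (X Y X' Y' : mxs R) : Defs.ortho ORow q1 q2 X Y X' Y' <->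
  [/\ factor_between u s X', factor_between s t Y' &
      @block_qr C (dual_system W) t s u
        (mx s t Y)^T (mx u s X)^T (mx s t Y')^T (mx u s X')^T].
Proof.
rewrite /Defs.ortho block_supportedE cols1 cols2.
have trE n p (Z : mxs R) : (tomx n p Z)^T = funmx p n (fun j i => ent Z i j).
  by apply/matrixP => i j; rewrite !mxE.
have qrP k := block_qr_funP (fun c j => ent Y j c) (fun c j => ent Y' j c)
  (fun j r => ent X r j) (fun j r => ent X' r j)
  (inCP_enumerates k) (inP_enumerates k) (inRP_enumerates k).
split=> [[[fX' fY'] qr]|[fX' fY' [_ _ qr]]]; split=> //.
  split; [by apply/supported_dual; case: fY'|by apply/supported_dual; case: fX'|move=> k /=].
  rewrite class_dual rowset_dual colset_dual !trE; apply/qrP.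
  have [Q [Rm [Rup [Qiso YE Y'E X'E]]]] := qr k (ltn_ord k).
  exists Q, Rm; split=> //; split=> // [c j cC jP|c j cC jP|j r jP rR]; first exact: YE.
    exact: Y'E.
  by rewrite X'E //; apply: eq_bigr => j' _; apply: mulrC.
move=> i iN; have /= := qr (Ordinal iN); rewrite class_dual rowset_dual colset_dual !trE.
move=> /qrP[Q [Rm [Rup [Qiso YE Y'E X'E]]]].
exists Q, Rm; split=> //; split=> // [j c jP cC|j c jP cC|r j rR jP]; first exact: YE.
  exact: Y'E.
by rewrite X'E //; apply: eq_bigr => j' _; apply: mulrC.
Qed.

Lemma ortho_exists dir (X Y : mxs R) : exists X' Y', Defs.ortho dir q1 q2 X Y X' Y'.
Proof.
case: dir.
  have [X' [Y' qr]] := block_qr_exists below_us below_st (mx u s X) (mx s t Y).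
  have [sX' sY' _] := qr; exists (MX X'), (MX Y'); apply/ortho_colE.
  by split; rewrite /tomx ?funmx_ent //; apply: factor_MX.
have [Y' [X' qr]] := @block_qr_exists C (dual_system W) t s u below_st below_us
  (mx s t Y)^T (mx u s X)^T.
have [sY' sX' _] := qr; exists (MX X'^T), (MX Y'^T); apply/ortho_rowE.
split; rewrite /tomx ?funmx_ent ?trmxK //.
  by apply/factor_MX/supported_dual; rewrite trmxK.
by apply/factor_MX/supported_dual; rewrite trmxK.
Qed.

Lemma ortho_mul dir (X Y X' Y' : mxs R) :
  factor_between u s X -> factor_between s t Y -> Defs.ortho dir q1 q2 X Y X' Y' ->
  mx u s X' *m mx s t Y' = mx u s X *m mx s t Y.
Proof.
case=> _ _ sX [_ _ sY]; case: dir => [/ortho_colE|/ortho_rowE] [_ _ qr].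
  exact: (@block_qr_mul C W u s t below_us below_st _ _ _ _ qr sX sY).
apply: trmx_inj; rewrite !trmx_mul.
exact: (@block_qr_mul C (dual_system W) t s u below_st below_us _ _ _ _ qr
  ((supported_dual _).2 sY) ((supported_dual _).2 sX)).
Qed.

End Pair.
End ArchitectureFactors.

(** * The butterfly algorithm *)

Lemma nth2_split (T : Type) (d : T) (s : seq T) k : (k.+1 < size s)%N ->
  s = take k s ++ nth d s k :: nth d s k.+1 :: drop k.+2 s.
Proof. by move=> kS; rewrite -!drop_nth ?cat_take_drop // ltnW. Qed.

Lemma set_nth2_cat (T : Type) (d : T) s1 x y x' y' s2 :
  set_nth d (set_nth d (s1 ++ x :: y :: s2) (size s1) x') (size s1).+1 y' =
  s1 ++ x' :: y' :: s2.
Proof. by elim: s1 => //= z s1 ->. Qed.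

Section States.
Variables (R : realType) (beta : seq pattern).
Local Notation C := R[i].
Local Notation L := (size beta).
Local Notation N := (arch_dim beta).
Local Notation mx u t X := (tomx (N u) (N t) X).
Local Notation state := (state R).
Hypothesis beta_arch : butterfly_arch beta.
Local Notation W := (arch_system beta_arch).
Local Notation factor_between := (factor_between beta_arch).

Lemma EerrE s (A : mxs R) : (0 < s < L)%N -> nr A = N 0 -> nc A = N L ->
  Eerr beta s A = @dist_products R W 0%N L s (mx 0 L A).
Proof.
move=> /andP[s_gt0 sL] rA cA; have s0 : (0 < s <= L)%N by lia.
have sLL : (s < L <= L)%N by lia.
rewrite /Eerr /dist_products; congr inf; apply/seteqP; split=> x /= [X [Y]].
  move=> [/(is_factorE beta_arch _ s0)[rX cX sX]].
  move=> /(is_factorE beta_arch _ sLL)[rY cY sY] ->.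
  by exists (mx 0 s X), (mx s L Y); rewrite (frob_subx _ rA cA) (tomx_mulx _ _ _ cX).
move=> [sX sY ->]; exists (MX X), (MX Y); split.
- exact/(is_factorE beta_arch _ s0)/factor_MX.
- exact/(is_factorE beta_arch _ sLL)/factor_MX.
- by rewrite (frob_subx _ rA cA) (@tomx_mulx _ _ (N s)) // /tomx !funmx_ent.
Qed.

(* The input matrix, which is the factor of the initial interval, need not be
   supported on the product pattern. *)
Definition piece u t (X : mxs R) :=
  [/\ nr X = N u, nc X = N t & (u, t) != (0, L)%N -> @supported W C u t (mx u t X)].

Fixpoint tiles u (st : state) v : Prop :=
  if st is ((q, t), X) :: st' then [/\ q = u.+1, (u < t)%N, piece u t X & tiles t st' v]
  else u = v.

Fixpoint state_prod u (st : state) v : 'M[C]_(N u, N v) :=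
  if st is ((_, t), X) :: st' then mx u t X *m state_prod t st' v else pid_mx (N u).

Lemma tiles_cat u st1 st2 v :
  tiles u (st1 ++ st2) v <-> exists2 w, tiles u st1 w & tiles w st2 v.
Proof.
elim: st1 u => [|[[q t] X] st1 IH] u /=; first by split=> [|[w ->]]; first exists u.
split=> [[-> ut pX /IH[w til1 til2]]|[w [-> ut pX til1] til2]]; first by exists w.
by split=> //; apply/IH; exists w.
Qed.

Lemma tiles_size u st v : tiles u st v -> (u + size st <= v)%N.
Proof.
elim: st u => [|[[q t] X] st IH] u /=; first by move->; rewrite addn0.
by case=> _ ut _ /IH; lia.
Qed.

Lemma tiles_le u st v : tiles u st v -> (u <= v)%N.
Proof. by move/tiles_size; lia. Qed.

Lemma tiles_end u st v v' : tiles u st v -> tiles u st v' -> v = v'.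
Proof.
by elim: st u => [|[[q t] X] st IH] u /= => [-> //|[_ _ _ h] [_ _ _]]; apply: IH.
Qed.

Lemma tiles_find u st v s : tiles u st v -> (u < s <= v)%N ->
  exists st1 w t X st2, [/\ st = st1 ++ ((w.+1, t), X) :: st2, (w < s <= t)%N,
    tiles u st1 w & tiles t st2 v].
Proof.
elim: st u => [|[[q t] X] st IH] u /=; first by move=> ->; lia.
case=> -> ut pX til us; have [st'|ts] := leqP s t.
  by exists [::], u, t, X, st; split=> //; case/andP: us => -> _.
have [|st1 [w' [t' [X' [st2 [-> sw til1 til2]]]]]] := IH t til; first by lia.
by exists (((u.+1, t), X) :: st1), w', t', X', st2.
Qed.

Lemma state_prod_cat u st1 w st2 v : tiles u st1 w ->
  state_prod u (st1 ++ st2) v = state_prod u st1 w *m state_prod w st2 v.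
Proof.
elim: st1 u => [|[[q t] X] st1 IH] u /=; first by move->; rewrite pid_mx_1 mul1mx.
by case=> _ _ _ /IH ->; rewrite mulmxA.
Qed.

Lemma tomx_foldl_mulx u X t st v : nc X = N t -> tiles t st v ->
  mx u v (foldl (@mulx R) X (map snd st)) = mx u t X *m state_prod t st v.
Proof.
elim: st t X => [|[[q t'] Y] st IH] t X cX /=; first by move<-; rewrite pid_mx_1 mulmx1.
by case=> _ _ [rY cY _] til; rewrite (IH t') // (tomx_mulx _ _ _ cX) mulmxA.
Qed.

Lemma supported_state_prod u st v : tiles u st v -> (v <= L)%N -> (u, v) != (0, L)%N ->
  @supported W C u v (state_prod u st v).
Proof.
elim: st u => [|[[q t] X] st IH] u /=.
  move=> -> _ _ i j; have [->|nij] := eqVneq i j; first by rewrite linkedxx.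
  by rewrite pid_mx_1 mxE (negPf nij) eqxx.
move=> [_ ut [_ _ sX] til] vL nuv; have tv := tiles_le til.
have ntv : (t, v) != (0, L)%N by apply/eqP => -[]; lia.
apply: (@supported_mul W C u t v) => //; try by rewrite below_archE; lia.
  by apply: sX; apply: contraNneq nuv => -[-> tL]; apply/eqP; congr pair; lia.
exact: IH.
Qed.

Lemma factor_piece u t X : factor_between u t X -> piece u t X.
Proof. by case. Qed.

Lemma ortho_step_decomp dir k st st' : tiles 0 st L -> ortho_step dir beta k st st' ->
  exists st1 st2 u s t X Y X' Y',
  [/\ st = st1 ++ ((u.+1, s), X) :: ((s.+1, t), Y) :: st2,
      st' = st1 ++ ((u.+1, s), X') :: ((s.+1, t), Y') :: st2,
      k = (size st1).+1,
      tiles 0 st1 u /\ tiles t st2 L &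
      [/\ (u < s)%N, (s < t)%N, factor_between u s X, factor_between s t Y &
          Defs.ortho dir (prodpat beta u.+1 s) (prodpat beta s.+1 t) X Y X' Y']].
Proof.
case: k => [|k] til [//= kS]; have stE := nth2_split (dflt_entry R) kS.
have st1S : size (take k st) = k by rewrite size_takel // ltnW // ltnW.
move: stE; case: (nth _ st k) => -[q s] X; case: (nth _ st k.+1) => -[q' t] Y stE /=.
move=> [X' [Y' [qr st'E]]].
move: til; rewrite stE => /tiles_cat[u til1 /=].
move=> [qE us [rX cX sX] [q'E s_t [rY cY sY] til2]].
subst q q'; have tL := tiles_le til2.
exists (take k st), (drop k.+2 st), u, s, t, X, Y, X', Y'; split=> //; last 1 first.
- by split=> //; split=> //; [apply: sX|apply: sY]; apply/eqP => -[]; lia.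
- rewrite st'E {1}stE.
  have := set_nth2_cat (dflt_entry R) (take k st) (u.+1, s, X) (s.+1, t, Y)
    (u.+1, s, X') (s.+1, t, Y') (drop k.+2 st).
  by rewrite st1S.
- by rewrite st1S.
Qed.

Lemma ortho_step_invariant dir k st st' : tiles 0 st L -> ortho_step dir beta k st st' ->
  [/\ tiles 0 st' L, map fst st' = map fst st & state_prod 0 st' L = state_prod 0 st L].
Proof.
move=> til /(ortho_step_decomp til)[st1 [st2 [u [s [t [X [Y [X' [Y' []]]]]]]]]].
move=> -> -> _ [til1 til2] [us s_t fX fY qr]; have tL := tiles_le til2.
have XY := ortho_mul us s_t tL fX fY qr.
have [fX' fY'] : factor_between u s X' /\ factor_between s t Y'.
  by apply/block_supportedE => //; case: qr.
split.
- apply/tiles_cat; exists u => //=.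
  by split=> //; [apply: factor_piece|split=> //; apply: factor_piece].
- by rewrite !map_cat.
- by rewrite !(state_prod_cat _ _ til1) /= !mulmxA -!(mulmxA (state_prod 0 st1 u)) XY.
Qed.


Lemma ortho_step_exists dir k st : tiles 0 st L -> (0 < k < size st)%N ->
  exists st', ortho_step dir beta k st st'.
Proof.
case: k => [//|k] til kS; have stE := nth2_split (dflt_entry R) kS.
case e1 : (nth _ st k) stE => [[q s] X]; case e2 : (nth _ st k.+1) => [[q' t] Y] stE.
have := til; rewrite {1}stE => /tiles_cat[u _ /= [qE us _ [q'E s_t _ til2]]]; subst q q'.
have [X' [Y' qr]] := ortho_exists beta_arch us s_t (tiles_le til2) dir X Y.
exists (set_nth (dflt_entry R) (set_nth (dflt_entry R) st k ((u.+1, s), X')) k.+1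
  ((s.+1, t), Y')).
by split=> //=; exists X', Y'; rewrite e1 e2.
Qed.

Definition left_orthonormal st := forall u, tiles 0 st u ->
  @label_orthonormal C W 0%N u (state_prod 0 st u).

Definition right_orthonormal st := forall u, tiles u st L ->
  @label_orthonormal C (dual_system W) L u (state_prod u st L)^T.

Lemma ortho_step_col k st st' : tiles 0 st L -> ortho_step OCol beta k st st' ->
  left_orthonormal (take k.-1 st) -> left_orthonormal (take k st').
Proof.
move=> til /(ortho_step_decomp til)[st1 [st2 [u [s [t [X [Y [X' [Y' []]]]]]]]]].
move=> -> -> -> [til1 til2] [us s_t fX fY qr]; have tL := tiles_le til2.
have [_ _ [sX' _ qrX]] := (ortho_colE beta_arch us s_t tL _ _ _ _).1 qr.
rewrite /= take_size_cat // => orth1.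
have -> T (e : T) s1 s2 : take (size s1).+1 (s1 ++ e :: s2) = s1 ++ [:: e].
  by rewrite -cat1s catA take_size_cat // size_cat addn1.
move=> v /tiles_cat[w til1']; rewrite -(tiles_end til1 til1') => -[_ _ _ <-].
rewrite (state_prod_cat _ _ til1) /= pid_mx_1 mulmx1.
apply: (@label_orthonormal_mul C W 0%N u s) => //; first by rewrite below_archE; lia.
  exact: orth1.
by move=> k0; have [Rm []] := qrX k0.
Qed.

Lemma ortho_step_row k st st' : tiles 0 st L -> ortho_step ORow beta k st st' ->
  right_orthonormal (drop k.+1 st) ->
  right_orthonormal (drop k st') /\ take k.-1 st' = take k.-1 st.
Proof.
move=> til /(ortho_step_decomp til)[st1 [st2 [u [s [t [X [Y [X' [Y' []]]]]]]]]].
move=> -> -> -> [til1 til2] [us s_t fX fY qr]; have tL := tiles_le til2.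
have [_ _ [sY' _ qrY]] := (ortho_rowE beta_arch us s_t tL _ _ _ _).1 qr.
rewrite /= !take_size_cat //.
have drop1 T (e : T) s1 s2 : drop (size s1).+1 (s1 ++ e :: s2) = s2.
  by rewrite -cat1s catA drop_size_cat // size_cat addn1.
have drop2 T (e e' : T) s1 s2 : drop (size s1).+2 (s1 ++ e :: e' :: s2) = s2.
  by rewrite -[e :: _]/([:: e; e'] ++ s2) catA drop_size_cat // size_cat addn2.
rewrite drop1 drop2 => orth2; split=> // v [[<-] _ _ til2'].
rewrite /= trmx_mul.
apply: (@label_orthonormal_mul C (dual_system W) L t s) => //; last first.
- by move=> k0; have [Rm []] := qrY k0.
- exact: orth2.
- by rewrite /=; lia.
Qed.

Lemma ortho_pass_invariant dir ks st st' : tiles 0 st L ->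
  rel_seq (ortho_step dir beta) ks st st' ->
  [/\ tiles 0 st' L, map fst st' = map fst st & state_prod 0 st' L = state_prod 0 st L].
Proof.
elim: ks st => [|k ks IH] st til /=; first by move=> ->.
case=> st1 [/(ortho_step_invariant til)[til1 fst1 prod1] /(IH _ til1)[til' fst' prod']].
by rewrite fst' prod'.
Qed.

Lemma col_pass_orthonormal k n st st' : tiles 0 st L ->
  rel_seq (ortho_step OCol beta) (iota k.+1 n) st st' ->
  left_orthonormal (take k st) -> left_orthonormal (take (k + n) st').
Proof.
elim: n k st => [|n IH] k st til /=; first by move=> ->; rewrite addn0.
case=> st1 [step pass] orth; have [til1 _ _] := ortho_step_invariant til step.
by rewrite addnS -addSn; apply: IH til1 pass _; apply: ortho_step_col step orth.
Qed.

Lemma row_pass_orthonormal j n st st' : tiles 0 st L ->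
  rel_seq (ortho_step ORow beta) (rev (iota j.+1 n)) st st' ->
  right_orthonormal (drop (j.+1 + n) st) ->
  right_orthonormal (drop j.+1 st') /\ take j st' = take j st.
Proof.
elim: n st => [|n IH] st til; first by move=> /= ->; rewrite addn0.
rewrite -[n.+1]addn1 iotaD rev_cat /= addn1 addnS.
case=> st1 [step pass] orth; have [til1 _ _] := ortho_step_invariant til step.
have [orth1 take1] := ortho_step_row til step orth.
have [orth' take'] := IH st1 til1 pass orth1; split=> //.
by rewrite take' -(take_takel st1 (leq_addr n j)) take1 take_takel // leq_addr.
Qed.

Lemma left_orthonormal_nil : left_orthonormal [::].
Proof.
by move=> _ <- i i' _; rewrite /= pid_mx_1 trmx1 map_mx1 mul1mx mxE.
Qed.

Lemma right_orthonormal_nil : right_orthonormal [::].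
Proof.
by move=> _ -> i i' _; rewrite /= pid_mx_1 trmxK map_mx1 trmx1 mulmx1 mxE.
Qed.

Lemma passes_orthonormal j n st st1 st2 : tiles 0 st L -> size st = (j.+1 + n)%N ->
  rel_seq (ortho_step OCol beta) (iota 1 j) st st1 ->
  rel_seq (ortho_step ORow beta) (rev (iota j.+1 n)) st1 st2 ->
  left_orthonormal (take j st2) /\ right_orthonormal (drop j.+1 st2).
Proof.
move=> til stS col row; have [til1 fst1 _] := ortho_pass_invariant til col.
have orth1 : left_orthonormal (take j st1).
  by apply: (col_pass_orthonormal til col); rewrite take0; apply: left_orthonormal_nil.
have [|orth2 take2] := row_pass_orthonormal til1 row; last by rewrite take2.
rewrite drop_oversize ?right_orthonormal_nil //; first exact: right_orthonormal_nil.
by rewrite -(size_map fst) fst1 size_map stS.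
Qed.

Lemma split_optimal a u v M b s X Y :
  tiles 0 (a ++ ((u.+1, v), M) :: b) L -> (u < s < v)%N ->
  left_orthonormal a -> right_orthonormal b ->
  twofactor (prodpat beta u.+1 s) (prodpat beta s.+1 v) M X Y ->
  let st' := a ++ [:: ((u.+1, s), X), ((s.+1, v), Y) & b] in
  tiles 0 st' L /\ exists (F : 'M[C]_(N 0, N s)) (G : 'M_(N s, N L)),
  [/\ @supported W C 0%N s F, @supported W C s L G, state_prod 0 st' L = F *m G &
      @block_optimal C W 0%N s L (state_prod 0 (a ++ ((u.+1, v), M) :: b) L) F G].
Proof.
move=> /tiles_cat[u' til_a /= [[uE] uv [rM cM sM] til_b]] /andP[us sv] orth_a orth_b tf.
subst u'; have vL := tiles_le til_b.
have [fX fY best] := (twofactorE beta_arch us sv vL _ _ _).1 tf.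
have [[_ _ sX] [_ _ sY]] := (fX, fY).
have [le0u leus lesv levL] : [/\ @below W 0%N u, @below W u s, @below W s v & @below W v L].
  by rewrite !below_archE; split; lia.
split.
  apply/tiles_cat; exists u => //=.
  by split=> //; [apply: factor_piece|split=> //; apply: factor_piece].
pose F := state_prod 0 a u; pose G := state_prod v b L.
have sF : @supported W C 0%N u F.
  by apply: supported_state_prod til_a _ _; [lia|apply/eqP => -[]; lia].
have sG : @supported W C v L G.
  by apply: supported_state_prod til_b _ _; [lia|apply/eqP => -[]; lia].
exists (F *m mx u s X), (mx s v Y *m G); split.
- exact: (supported_mul le0u leus).
- exact: (supported_mul lesv levL).
- by rewrite (state_prod_cat _ _ til_a) /= !mulmxA.
rewrite (state_prod_cat _ _ til_a) /= -/F -/G.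
have [[u0 vE]|proper] := eqVneq (u, v) (0%N, L); last first.
  have leuv := below_trans leus lesv; have lesL := below_trans lesv levL.
  apply: (@block_optimal_mull C W 0%N u s L) => //; last 1 first.
  - apply: (@block_optimal_mulr C W u s v L) => //; [exact: orth_b|exact: sM].
  - exact: orth_a.
  - apply: (supported_mul leuv levL) => //; exact: sM.
have [a0 b0] : a = [::] /\ b = [::].
  have := tiles_size til_a; have := tiles_size til_b; rewrite u0 vE.
  by split; apply: size0nil; lia.
by rewrite /F /G {}a0 {}b0; subst u v; rewrite /= !pid_mx_1 !mul1mx !mulmx1.
Qed.

End States.

Lemma rel_seq_exists (T : Type) (rel_k : nat -> T -> T -> Prop) (inv : T -> Prop) ks x :
  (forall k y, k \in ks -> inv y -> exists2 z, rel_k k y z & inv z) -> inv x ->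
  exists y, rel_seq rel_k ks x y.
Proof.
elim: ks x => [|k ks IH] x step inv_x; first by exists x.
have [z xz inv_z] := step k x (mem_head _ _) inv_x.
have [|y zy] := IH z _ inv_z; last by exists y, z.
by move=> k' y k'ks; apply: step; rewrite in_cons k'ks orbT.
Qed.

Section Run.
Variables (R : realType) (beta : seq pattern).
Local Notation C := R[i].
Local Notation L := (size beta).
Local Notation N := (arch_dim beta).
Local Notation mx u t X := (tomx (N u) (N t) X).
Local Notation state := (state R).
Hypothesis beta_arch : butterfly_arch beta.
Let L_gt0 : (0 < L)%N. Proof. by case: beta_arch. Qed.
Local Notation W := (arch_system beta_arch).
Local Notation tiles := (tiles beta_arch).
Local Notation dist := (@dist_products R W 0%N L).

Variables (A : mxs R) (sigma : seq nat).
Hypotheses (rowsA : nr A = N 0) (colsA : nc A = N L).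
Hypothesis sigmaP : perm_eq sigma (iota 1 L.-1).

Lemma size_sigma : size sigma = L.-1.
Proof. by rewrite (perm_size sigmaP) size_iota. Qed.

Lemma nth_sigma k : (k < L.-1)%N ->
  (0 < nth 0 sigma k < L)%N /\ nth 0%N sigma k \notin take k sigma.
Proof.
move=> kL; have kS : (k < size sigma)%N by rewrite size_sigma.
have := mem_nth 0%N kS; rewrite (perm_mem sigmaP) mem_iota add1n prednK // => ->.
split=> //; have : uniq sigma by rewrite (perm_uniq sigmaP) iota_uniq.
rewrite -{1}(cat_take_drop k sigma) (drop_nth 0%N kS) cat_uniq => /and3P[_ /norP[] //].
Qed.

Lemma take_sigma k : (k < L.-1)%N ->
  take k.+1 sigma = rcons (take k sigma) (nth 0%N sigma k).
Proof. by move=> kL; rewrite (take_nth 0%N) ?size_sigma. Qed.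

Definition error_bounded k (B : 'M[C]_(N 0, N L)) :=
  frob (MX (mx 0 L A - B)) <= \sum_(i < k) Eerr beta (nth 0%N sigma i) A /\
  forall s, (0 < s < L)%N -> s \notin take k sigma -> dist s B <= dist s (mx 0 L A).

Lemma error_bounded0 : error_bounded 0 (mx 0 L A).
Proof.
split=> //; rewrite big_ord0 subrr /frob big1 ?sqrtr0 // => i _.
by rewrite big1 // => j _; rewrite mxE /cnorm ComplexField.Normc.normc0 expr0n.
Qed.

Lemma error_bounded_step k (s := nth 0%N sigma k) B
    (F : 'M_(N 0, N s)) (G : 'M_(N s, N L)) :
  (k < L.-1)%N -> error_bounded k B ->
  @supported W C 0%N s F -> @supported W C s L G ->
  @block_optimal C W 0%N s L B F G -> error_bounded k.+1 (F *m G).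
Proof.
move=> kL [bound dist_le] sF sG best; have [sL sk] := nth_sigma kL.
rewrite -/s in sL sk.
have le0s : @below W 0%N s by rewrite below_archE; lia.
have lesL : @below W s L by rewrite below_archE; lia.
split=> [|s' s'L]; last first.
  rewrite (take_sigma kL) mem_rcons in_cons => /norP[s's s'k].
  apply: le_trans (dist_le s' s'L s'k).
  have le0s' : @below W 0%N s' by rewrite below_archE; lia.
  have les'L : @below W s' L by rewrite below_archE; lia.
  apply: (@dist_products_contract R W 0%N L s) => //.
  by rewrite !below_archE; move: s's; case: (ltngtP s s') => // ltss' _; [left|right]; lia.
have -> : mx 0 L A - F *m G = (mx 0 L A - B) + (B - F *m G) by rewrite addrA subrK.
apply: le_trans (frobD _ _) _; rewrite big_ord_recr /=; apply: lerD => //.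
rewrite -/s (EerrE beta_arch sL rowsA colsA).
exact: le_trans (block_optimal_dist le0s lesL best sF sG) (dist_le s sL sk).
Qed.

Definition interval_ends (st : state) := map (fun e => e.1.2) st.

Definition run_invariant k (st : state) :=
  [/\ tiles 0 st L, size st = k.+1,
      forall x, (x \in interval_ends st) = (x == L) || (x \in take k sigma) &
      error_bounded k (state_prod beta 0 st L)].

Lemma run_invariant0 : run_invariant 0 [:: ((1, L)%N, A)].
Proof.
have eA : state_prod beta 0 [:: ((1, L)%N, A)] L = mx 0 L A.
  by rewrite /= pid_mx_1 mulmx1.
split; last by rewrite eA; apply: error_bounded0.
- by split; [| |split; rewrite ?eqxx|].
- by [].
- by move=> x; rewrite take0 mem_seq1 orbF.
Qed.

Lemma sigma_inside_interval k st1 u t X st2 (s := nth 0%N sigma k) :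
  (k < L.-1)%N -> run_invariant k (st1 ++ ((u.+1, t), X) :: st2) ->
  (u.+1 <= s <= t)%N -> (u < s < t)%N.
Proof.
move=> kL [_ _ endsE _] /andP[us]; rewrite leq_eqVlt us => /predU1P[st|//].
have [sL sk] := nth_sigma kL; have := endsE s.
rewrite /interval_ends map_cat mem_cat in_cons /= -st eqxx orbT (negPf sk) orbF.
by move/esym/eqP => sE; move: sL; rewrite -/s sE ltnn andbF.
Qed.

Lemma run_invariant_pass dir ks k st st' : run_invariant k st ->
  rel_seq (ortho_step dir beta) ks st st' ->
  run_invariant k st' /\ map fst st' = map fst st.
Proof.
move=> [til stS endsE err] /(ortho_pass_invariant til)[til' fst' prod'].
split; last by [].
split; first by [].
- by rewrite -(size_map fst) fst' size_map.
- by move=> x; rewrite -endsE /interval_ends !(map_comp snd fst) fst'.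
- by rewrite prod'.
Qed.

Lemma run_invariant_split k a u v M b X Y (s := nth 0%N sigma k) :
  (k < L.-1)%N -> run_invariant k (a ++ ((u.+1, v), M) :: b) -> (u.+1 <= s <= v)%N ->
  left_orthonormal beta_arch a ->
  right_orthonormal beta_arch b ->
  twofactor (prodpat beta u.+1 s) (prodpat beta s.+1 v) M X Y ->
  run_invariant k.+1 (a ++ [:: ((u.+1, s), X), ((s.+1, v), Y) & b]).
Proof.
move=> kL inv usv orth_a orth_b tf; have usv' := sigma_inside_interval kL inv usv.
have [til stS endsE err] := inv.
have [til' [F [G [sF sG prodE best]]]] := split_optimal til usv' orth_a orth_b tf.
split; first exact: til'.
- by move: stS; rewrite !size_cat /= !addnS => ->.
- move=> x; rewrite (take_sigma kL) mem_rcons in_cons -/s orbCA -endsE.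
  by rewrite /interval_ends !map_cat !mem_cat /= !in_cons; case: (x == s); rewrite ?orbT.
- by rewrite prodE; apply: error_bounded_step best.
Qed.

Lemma run_invariant_step k st st' : (k < L.-1)%N -> run_invariant k st ->
  bstep beta k.+1 (nth 0%N sigma k) st st' -> run_invariant k.+1 st'.
Proof.
move=> kL inv [[|j] [// jS] [qst [st1 [st2 [col [row [X [Y [tf ->]]]]]]]]].
have [inv1 fst1] := run_invariant_pass inv col.
have [inv2 fst2] := run_invariant_pass inv1 row.
have [til stS _ _] := inv; have [til2 st2S _ _] := inv2.
have [|orth_a orth_b] := passes_orthonormal til _ col row; first by rewrite stS; lia.
have jS2 : (j < size st2)%N by rewrite st2S -stS; lia.
have st2E : st2 = take j st2 ++ nth (dflt_entry R) st2 j :: drop j.+1 st2.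
  by rewrite -drop_nth // cat_take_drop.
have nthE : (nth (dflt_entry R) st2 j).1 = (nth (dflt_entry R) st j).1.
  rewrite -!(nth_map _ (0, 0)%N fst) ?fst2 ?fst1 //; lia.
move: qst tf st2E; rewrite /= -nthE.
case: (nth _ st2 j) => -[q v] M /= qsv tf st2E; rewrite st2E in til2 inv2.
have [u _ /= [qE _ _ _]] := (tiles_cat _ _ _ _ _).1 til2.
subst q; exact: run_invariant_split inv2 qsv orth_a orth_b tf.
Qed.

Lemma ortho_pass_exists dir ks k st : run_invariant k st ->
  (forall i, i \in ks -> 0 < i <= k)%N ->
  exists st', rel_seq (ortho_step dir beta) ks st st'.
Proof.
move=> inv ks_le; apply: (rel_seq_exists (inv := run_invariant k)) inv => i y /ks_le i_le inv_y.
have [til yS _ _] := inv_y.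
have [|z step] := @ortho_step_exists R beta beta_arch dir i y til.
  by rewrite yS; lia.
have [] := @run_invariant_pass dir [:: i] k y z inv_y; first by exists z.
by exists z.
Qed.

Lemma bstep_exists k st : (k < L.-1)%N -> run_invariant k st ->
  exists st', bstep beta k.+1 (nth 0%N sigma k) st st'.
Proof.
move=> kL inv; have [til stS _ _] := inv; have [sL _] := nth_sigma kL.
have sL' : (0 < nth 0 sigma k <= L)%N by lia.
have [a [u [t [X [b [stE ust til_a til_b]]]]]] := tiles_find til sL'.
rewrite stE in inv stS *; have usT := sigma_inside_interval kL inv ust.
move: stS; rewrite size_cat /= => stS.
have [i|st1 col] := @ortho_pass_exists OCol (iota 1 (size a)) _ _ inv.
  by rewrite mem_iota; lia.
have [inv1 _] := run_invariant_pass inv col.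
have [i|st2 row] :=
  @ortho_pass_exists ORow (rev (iota (size a).+1 (k.+1 - (size a).+1))) _ _ inv1.
  by rewrite mem_rev mem_iota; lia.
have /andP[us s_t] := usT.
have [X' [Y' tf]] := twofactor_exists beta_arch us s_t (tiles_le til_b)
  (nth (dflt_entry R) st2 (size a)).2.
eexists; exists (size a).+1; split; first by rewrite size_cat /=; lia.
rewrite /= nth_cat ltnn subnn /=; split=> //.
by exists st1, st2; split=> //; split=> //; exists X', Y'.
Qed.

Lemma run_exists_invariant n k st : (k + n = L.-1)%N -> run_invariant k st ->
  let run := rel_seq (fun J => bstep beta J (nth 0%N sigma J.-1)) (iota k.+1 n) st in
  (exists stf, run stf) /\ forall stf, run stf -> run_invariant L.-1 stf.
Proof.
elim: n k st => [|n IH] k st kn inv /=.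
  by rewrite addn0 in kn; split=> [|stf ->]; [exists st|rewrite -kn].
have kL : (k < L.-1)%N by lia.
have kn' : (k.+1 + n = L.-1)%N by lia.
split=> [|stf [st' [step]]]; last first.
  by have [_] := IH _ _ kn' (run_invariant_step kL inv step); apply.
have [st' step] := bstep_exists kL inv.
have [[stf run] _] := IH _ _ kn' (run_invariant_step kL inv step).
by exists stf, st'.
Qed.

Lemma tiles_unit u st v : tiles u st v -> (u + size st = v)%N ->
  forall i, (i < size st)%N ->
  piece beta_arch (u + i) (u + i).+1 (nth (dflt_entry R) st i).2.
Proof.
elim: st u => [//|[[q t] X] st IH] u /= [-> ut pX til] stS.
have tE : t = u.+1 by have := tiles_size til; lia.
subst t; case=> [|i] iS /=; first by rewrite addn0.
by have := IH _ til _ i iS; rewrite !addSnnS; apply.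
Qed.

Lemma run_invariant_final st : (1 < L)%N -> run_invariant L.-1 st ->
  in_Sigma beta (map snd st) /\
  frob (subx A (prodx (map snd st))) <= \sum_(k < L.-1) Eerr beta (nth 0%N sigma k) A.
Proof.
move=> L_gt1 [til stS _ [bound _]]; rewrite prednK // in stS; split.
  split=> [|[//|l] /andP[_ lL]]; first by rewrite size_map.
  have lS : (l < size st)%N by rewrite stS.
  have [rX cX sX] := tiles_unit til stS lS; rewrite add0n in rX cX sX.
  have lL' : (l < l.+1 <= L)%N by rewrite ltnSn.
  rewrite (nth_map (dflt_entry R)) //= -[pat beta l.+1](_ : prodpat beta l.+1 l.+1 = _).
    apply/(is_factorE beta_arch _ lL'); split=> //.
    by apply: sX; apply/eqP => -[]; lia.
  by rewrite /prodpat subnn.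
suff prodE : mx 0 L (prodx (map snd st)) = state_prod beta 0 st L.
  by rewrite (frob_subx _ rowsA colsA) prodE.
case: st til {stS bound} => [L0|[[q t] X] st [_ _ [_ cX _] til]].
  by move: L_gt1; rewrite -L0.
exact: (tomx_foldl_mulx _ cX til).
Qed.

End Run.

Theorem theorem7p2 (R : realType) (beta : seq pattern) (sigma : seq nat)
    (m n : nat) (A : 'M[R[i]]_(m, n)) :
  (2 <= size beta)%N ->
  is_arch beta -> chainable_arch beta -> ~ redundant_arch beta ->
  m = (pa (pat beta 1) * pb (pat beta 1) * pd (pat beta 1))%N ->
  n = (pa (pat beta (size beta)) * pc (pat beta (size beta)) * pd (pat beta (size beta)))%N ->
  perm_eq sigma (iota 1 (size beta).-1) ->
  (exists out, butterfly beta sigma (MX A) out) /\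
  forall out, butterfly beta sigma (MX A) out ->
    in_Sigma beta out /\
    frob (subx (MX A) (prodx out)) <=
      \sum_(k < (size beta).-1) Eerr beta (nth 0%N sigma k) (MX A).
Proof.
move=> L_gt1 arch chain nonredundant mE nE sigmaP.
have beta_arch : butterfly_arch beta by split=> //; apply: ltnW.
have rowsA : nr (MX A) = arch_dim beta 0 by [].
have colsA : nc (MX A) = arch_dim beta (size beta).
  by rewrite /= nE; case: (size beta) L_gt1.
have inv0 := run_invariant0 beta_arch sigma rowsA colsA.
have [[stf run] inv] := run_exists_invariant rowsA colsA sigmaP (add0n _) inv0.
split; first by exists (map snd stf), stf.
by move=> _ [stf' [/inv final ->]]; apply: run_invariant_final final.
Qed.
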